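(* Let $K$ be a field, let $\mathbb{X}\subseteq\mathbb{P}^n_K$ be a $0$-dimensional locally Gorenstein scheme with no point of $\mathrm{Supp}(\mathbb{X})$ on the hyperplane $X_0=0$, and let $\sigma$ be a homogeneous trace map of degree zero of $Q^h(R)/L_0$. Then the scheme $\mathbb{X}$ has minimal Dedekind different if and only if $\mathbb{X}$ is a Cayley-Bacharach scheme and $\mathfrak{F}_{\widetilde R/R}^2=\delta^\sigma_{\mathbb{X}}$.
   Context: Setting. $P=K[X_0,\dots,X_n]$ has the standard grading, $I_{\mathbb{X}}\subseteq P$ is the (saturated) homogeneous vanishing ideal of $\mathbb{X}$, $R=P/I_{\mathbb{X}}$, and $\mathrm{Supp}(\mathbb{X})=\{p_1,\dots,p_s\}$ is the set of closed points. The residue class $x_0$ of $X_0$ in $R$ is a non-zerodivisor. $\mathcal{O}_{\mathbb{X},p_j}$ is the local ring at $p_j$, with residue field $\kappa(p_j)$; $\varkappa_j=\dim_K\kappa(p_j)$; $\deg(\mathbb{X})=\sum_j\dim_K\mathcal{O}_{\mathbb{X},p_j}$. $\mathrm{HF}_{\mathbb{X}}(i)=\dim_KR_i$, and $r_{\mathbb{X}}$ is the least integer such that $\mathrm{HF}_{\mathbb{X}}(i)=\deg(\mathbb{X})$ for all $i\ge r_{\mathbb{X}}$. $\mathbb{X}$ is locally Gorenstein if every $\mathcal{O}_{\mathbb{X},p_j}$ is a Gorenstein ring. $Q^h(R)$ is the localization of $R$ at all homogeneous non-zerodivisors; $Q^h(R)=R_{x_0}\cong\prod_{j=1}^s\mathcal{O}_{\mathbb{X},p_j}[T_j,T_j^{-1}]$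 with $\deg T_j=1$, via the injection $\tilde\imath:R\to Q^h(R)$, $\tilde\imath(f)=(f_{p_1}T_1^i,\dots,f_{p_s}T_s^i)$ for $f\in R_i$, where $f_{p_j}$ is the germ of $f$ at $p_j$ (the image of $f/x_0^i$ in $\mathcal{O}_{\mathbb{X},p_j}$). Conductor. $\widetilde R=\prod_{j=1}^s\mathcal{O}_{\mathbb{X},p_j}[T_j]$, which contains $R$ via $\tilde\imath$, and $\mathfrak{F}_{\widetilde R/R}=\{f\in\widetilde R\mid f\widetilde R\subseteq R\}$. Dedekind different. $L_0=K[x_0,x_0^{-1}]$. A homogeneous trace map of degree zero of $Q^h(R)/L_0$ is a homogeneous element $\sigma$ of degree $0$ of the graded module $\underline{\mathrm{Hom}}_{L_0}(Q^h(R),L_0)$ which is a $Q^h(R)$-basis of it; it exists when $\mathbb{X}$ is locally Gorenstein. The Dedekind complementary module $\mathfrak{C}^\sigma_{\mathbb{X}}\subseteq Q^h(R)$ is the image of the injection $\underline{\mathrm{Hom}}_{K[x_0]}(R,K[x_0])\to\underline{\mathrm{Hom}}_{L_0}(Q^h(R),L_0)=Q^h(R)\sigma\cong Q^h(R)$, $\varphi\mapsto\varphi\otimes\mathrm{id}_{L_0}$ (the last isomorphism sending $g\sigma$ to $g$). The Dedekind different is $\delta^\sigma_{\mathbb{X}}=\{f\in Q^h(R)\mid f\cdot\mathfrak{C}^\sigma_{\mathbb{X}}\subseteq R\}$, a homogeneous ideal of $R$. $\mathbb{X}$ has minimal Dedekind different if $\delta^\sigma_{\mathbb{X}}=\bigoplus_{i\ge2r_{\mathbb{X}}}R_i$.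 Cayley-Bacharach. A subscheme $\mathbb{Y}\subseteq\mathbb{X}$ is a $p_j$-subscheme if $\mathcal{O}_{\mathbb{Y},p_k}=\mathcal{O}_{\mathbb{X},p_k}$ for $k\ne j$ and $\mathcal{O}_{\mathbb{X},p_j}\to\mathcal{O}_{\mathbb{Y},p_j}$ is surjective; it is maximal if $\deg(\mathbb{Y})=\deg(\mathbb{X})-\varkappa_j$. Maximal $p_j$-subschemes correspond bijectively to the ideals $\langle s_j\rangle$ of $\mathcal{O}_{\mathbb{X},p_j}$ generated by a nonzero socle element $s_j$ (with $\mathcal{O}_{\mathbb{Y},p_j}=\mathcal{O}_{\mathbb{X},p_j}/\langle s_j\rangle$). For $a\in\mathcal{O}_{\mathbb{X},p_j}$ put $\mu(a)=\min\{i\in\mathbb{N}\mid(0,\dots,0,aT_j^i,0,\dots,0)\in\tilde\imath(R)\}$ (entry in position $j$). If $e_{j1},\dots,e_{j\varkappa_j}\in\mathcal{O}_{\mathbb{X},p_j}$ have residue classes forming a $K$-basis of $\kappa(p_j)$, put $\mu_{\mathbb{Y}/\mathbb{X}}=\max_k\mu(e_{jk}s_j)$ (independent of the choices). $\deg_{\mathbb{X}}(p_j)$ is the minimum of $\mu_{\mathbb{Y}/\mathbb{X}}$ over all maximal $p_j$-subschemes $\mathbb{Y}$; one has $\deg_{\mathbb{X}}(p_j)\le r_{\mathbb{X}}$. $\mathbb{X}$ is a Cayley-Bacharach scheme if $\deg_{\mathbb{X}}(p_j)=r_{\mathbb{X}}$ for all $j$. *)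

(* Defs.v *)
From HB Require Import structures.
From mathcomp Require Import all_boot all_order all_algebra.
From mathcomp Require Import ring.
From mathcomp Require Import mpoly.
From mathcomp Require Import boolp classical_sets cardinality fsbigop.

Set Implicit Arguments.
Unset Strict Implicit.
Unset Printing Implicit Defensive.

Import Order.TTheory GRing.Theory.
Local Open Scope ring_scope.
Local Open Scope quotient_scope.
Local Open Scope classical_set_scope.

(* The value is 0 if no natural number satisfies Q. *)
Definition natmin (Q : nat -> Prop) : nat :=
  match pselect (exists k, `[< Q k >]) with
  | left h => ex_minn h
  | right _ => 0%N
  end.

(* Localization of a commutative, possibly zero, ring A at a multiplicative   *)
(* subset S; loc_frac a s is the class of a / s, and 0 if s is not in S.      *)

Record mulset (A : comPzRingType) := Mulset {
  mulset_pred :> A -> Prop;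
  mulset1 : mulset_pred 1;
  mulsetM : forall a b, mulset_pred a -> mulset_pred b -> mulset_pred (a * b)
}.

Section Localization.
Variables (A : comPzRingType) (S : mulset A).

Record fracpair := Fracpair { num : A; den : A; denP : S den }.

HB.instance Definition _ := gen_eqMixin fracpair.
HB.instance Definition _ := gen_choiceMixin fracpair.

Definition loc_equiv (x y : fracpair) : bool :=
  `[< exists2 u, S u & u * (num x * den y) = u * (num y * den x) >].

Lemma loc_equiv_refl : reflexive loc_equiv.
Proof. by move=> x; apply/asboolP; exists 1 => //; exact: mulset1. Qed.

Lemma loc_equiv_sym : ssrbool.symmetric loc_equiv.
Proof.
have h x y : loc_equiv x y -> loc_equiv y x.
  by move=> /asboolP[u Su e]; apply/asboolP; exists u.
by move=> x y; apply/idP/idP; exact: h.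
Qed.

Lemma loc_equiv_trans : transitive loc_equiv.
Proof.
move=> y x z /asboolP[u Su e] /asboolP[v Sv f]; apply/asboolP.
exists (u * v * den y); first by do !apply: mulsetM => //; exact: denP.
transitivity (v * den z * (u * (num x * den y))); first by ring.
rewrite e; transitivity (u * den x * (v * (num y * den z))); first by ring.
by rewrite f; ring.
Qed.

Canonical loc_equivR :=
  EquivRel loc_equiv loc_equiv_refl loc_equiv_sym loc_equiv_trans.

Definition loc := {eq_quot loc_equiv}.

HB.instance Definition _ : EqQuotient _ loc_equiv loc := EqQuotient.on loc.
HB.instance Definition _ := Choice.on loc.

Lemma loc_eqP (x y : fracpair) :
  \pi_loc x = \pi_loc y <->
  exists2 u, S u & u * (num x * den y) = u * (num y * den x).
Proof.
split; first by move=> /eqmodP /asboolP.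
by move=> h; apply/eqmodP/asboolP.
Qed.

Definition fp_embed (a : A) := Fracpair a (mulset1 S).
Definition fp_add (x y : fracpair) :=
  Fracpair (num x * den y + num y * den x) (mulsetM (denP x) (denP y)).
Definition fp_opp (x : fracpair) := Fracpair (- num x) (denP x).
Definition fp_mul (x y : fracpair) :=
  Fracpair (num x * num y) (mulsetM (denP x) (denP y)).

Definition loc_zero : loc := \pi_loc (fp_embed 0).
Definition loc_one : loc := \pi_loc (fp_embed 1).
Definition loc_add (x y : loc) : loc := \pi_loc (fp_add (repr x) (repr y)).
Definition loc_opp (x : loc) : loc := \pi_loc (fp_opp (repr x)).
Definition loc_mul (x y : loc) : loc := \pi_loc (fp_mul (repr x) (repr y)).

Lemma loc_reprE (x : fracpair) : exists2 u, S u &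
  u * (num (repr (\pi_loc x)) * den x) = u * (num x * den (repr (\pi_loc x))).
Proof. by apply/loc_eqP; rewrite reprK. Qed.

Lemma loc_addE x y : loc_add (\pi_loc x) (\pi_loc y) = \pi_loc (fp_add x y).
Proof.
apply/loc_eqP.
have [u Su /=] := loc_reprE x; have [v Sv /=] := loc_reprE y.
set x' := repr (\pi_loc x); set y' := repr (\pi_loc y) => f e.
exists (u * v); first exact: mulsetM.
transitivity (v * (den y' * den y) * (u * (num x' * den x))
  + u * (den x' * den x) * (v * (num y' * den y))); first by ring.
by rewrite e f; ring.
Qed.

Lemma loc_oppE x : loc_opp (\pi_loc x) = \pi_loc (fp_opp x).
Proof.
apply/loc_eqP; have [u Su /= e] := loc_reprE x.
by exists u => //; rewrite !mulNr !mulrN e.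
Qed.

Lemma loc_mulE x y : loc_mul (\pi_loc x) (\pi_loc y) = \pi_loc (fp_mul x y).
Proof.
apply/loc_eqP.
have [u Su /=] := loc_reprE x; have [v Sv /=] := loc_reprE y.
set x' := repr (\pi_loc x); set y' := repr (\pi_loc y) => f e.
exists (u * v); first exact: mulsetM.
transitivity ((u * (num x' * den x)) * (v * (num y' * den y))); first by ring.
by rewrite e f; ring.
Qed.

Lemma loc_ext (x y : fracpair) :
  num x * den y = num y * den x -> \pi_loc x = \pi_loc y.
Proof.
by move=> e; apply/loc_eqP; exists 1; rewrite ?e //; exact: mulset1.
Qed.

Lemma loc_addA : associative loc_add.
Proof.
elim/quotW=> x; elim/quotW=> y; elim/quotW=> z.
by rewrite (loc_addE y z) (loc_addE x y) !loc_addE; apply: loc_ext => /=; ring.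
Qed.

Lemma loc_addC : commutative loc_add.
Proof.
elim/quotW=> x; elim/quotW=> y.
by rewrite !loc_addE; apply: loc_ext => /=; ring.
Qed.

Lemma loc_add0 : left_id loc_zero loc_add.
Proof.
by elim/quotW=> x; rewrite /loc_zero loc_addE; apply: loc_ext => /=; ring.
Qed.

Lemma loc_addN : left_inverse loc_zero loc_opp loc_add.
Proof.
elim/quotW=> x.
by rewrite loc_oppE loc_addE; apply: loc_ext => /=; ring.
Qed.

HB.instance Definition _ :=
  GRing.isZmodule.Build loc loc_addA loc_addC loc_add0 loc_addN.

Lemma loc_mulA : associative loc_mul.
Proof.
elim/quotW=> x; elim/quotW=> y; elim/quotW=> z.
by rewrite (loc_mulE y z) (loc_mulE x y) !loc_mulE; apply: loc_ext => /=; ring.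
Qed.

Lemma loc_mulC : commutative loc_mul.
Proof.
elim/quotW=> x; elim/quotW=> y.
by rewrite !loc_mulE; apply: loc_ext => /=; ring.
Qed.

Lemma loc_mul1 : left_id loc_one loc_mul.
Proof.
by elim/quotW=> x; rewrite /loc_one loc_mulE; apply: loc_ext => /=; ring.
Qed.

Lemma loc_mulD : left_distributive loc_mul +%R.
Proof.
elim/quotW=> x; elim/quotW=> y; elim/quotW=> z.
rewrite [X in loc_mul X _](loc_addE x y) !loc_mulE.
by rewrite [RHS]loc_addE; apply: loc_ext => /=; ring.
Qed.

HB.instance Definition _ :=
  GRing.Zmodule_isComPzRing.Build loc loc_mulA loc_mulC loc_mul1 loc_mulD.

Definition loc_frac (a s : A) : loc :=
  match pselect (S s) with
  | left Ss => \pi_loc (Fracpair a Ss)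
  | right _ => 0
  end.

Definition to_loc (a : A) : loc := loc_frac a 1.

End Localization.
Arguments loc {A} S.
Arguments to_loc {A} S a.

(* A homogeneous ideal; the unit ideal is allowed. *)
Definition homog_ideal (K : fieldType) (n : nat)
    (I : {mpoly K[n.+1]} -> bool) : Prop :=
  [/\ 0 \in I,
      forall f g, f \in I -> g \in I -> f + g \in I,
      forall f g, g \in I -> f * g \in I
    & forall f d, f \in I -> pihomog mdeg d f \in I].

(* A closed subscheme is given by its saturated homogeneous vanishing ideal;  *)
(* the empty scheme corresponds to the unit ideal.                            *)
Record pscheme (K : fieldType) (n : nat) := PScheme {
  vid_pred : {mpoly K[n.+1]} -> bool;
  vid_homog : homog_ideal vid_pred;
  vid_sat : forall f d,
    (forall m : 'X_{1..n.+1}, mdeg m = d -> 'X_[m] * f \in vid_pred) ->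
    f \in vid_pred
}.

(* Points of P^n: homogeneous primes that do not contain all the variables.   *)
Record ppoint (K : fieldType) (n : nat) := PPoint {
  pid : {mpoly K[n.+1]} -> bool;
  pid_homog : homog_ideal pid;
  pid_prime : forall f g, f * g \in pid -> f \in pid \/ g \in pid;
  pid_relevant : exists i : 'I_n.+1, 'X_i \notin pid
}.

Section Scheme.
Variables (K : fieldType) (n : nat).
Local Notation P := {mpoly K[n.+1]}.
Implicit Types (X Y : pscheme K n) (p : ppoint K n).

Definition vid X : {pred P} := vid_pred X.

Definition on_scheme X p := {subset vid X <= pid p}.

(* Dimension 0 in the sense of chains of points (irreducible closed subsets). *)
Definition zero_dimensional X : Prop :=
  (exists p, on_scheme X p) /\
  (forall p q, on_scheme X p -> on_scheme X q ->
     {subset pid p <= pid q} -> pid p =i pid q).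

Record supp X := Supp {
  spoint :> ppoint K n;
  supp_on : on_scheme X spoint;
  supp_closed : forall q, on_scheme X q ->
    {subset pid spoint <= pid q} -> {subset pid q <= pid spoint}
}.

HB.instance Definition _ X := gen_eqMixin (supp X).
HB.instance Definition _ X := gen_choiceMixin (supp X).

Definition off_hyperplane X : Prop := forall p : supp X, 'X_ord0 \notin pid p.

Definition subscheme Y X : Prop := {subset vid X <= vid Y}.

Lemma vid_zmod_closed X : zmod_closed (vid X).
Proof.
case: (vid_homog X) => I0 ID IM _; split=> // f g fI gI.
by rewrite -[- g]mulN1r; apply: ID => //; exact: IM.
Qed.

HB.instance Definition _ X :=
  GRing.isZmodClosed.Build P (vid X) (vid_zmod_closed X).

Definition coord X := Quotient.quot (vid X).

HB.instance Definition _ X := GRing.Zmodule.on (coord X).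
HB.instance Definition _ X : EqQuotient P (Quotient.equiv (vid X)) (coord X) :=
  EqQuotient.on (coord X).

Definition coord_pi X (f : P) : coord X := \pi_(coord X) f.

Lemma coord_piP X f g : coord_pi X f = coord_pi X g <-> f - g \in vid X.
Proof. by rewrite (Quotient.idealrBE (vid X)); split=> /eqP. Qed.

Lemma coord_reprP X f : repr (coord_pi X f) - f \in vid X.
Proof. by apply/coord_piP; rewrite /coord_pi reprK. Qed.

Definition coord_one X := coord_pi X 1.
Definition coord_mul X (a b : coord X) := coord_pi X (repr a * repr b).

Lemma coord_mulE X f g :
  coord_mul (coord_pi X f) (coord_pi X g) = coord_pi X (f * g).
Proof.
have [I0 ID IM _] := vid_homog X.
apply/coord_piP; set f' := repr _; set g' := repr _.
have -> : f' * g' - f * g = f' * (g' - g) + g * (f' - f) by ring.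
by apply: ID; apply: IM; exact: coord_reprP.
Qed.

Lemma coord_addE X f g : coord_pi X f + coord_pi X g = coord_pi X (f + g).
Proof. by rewrite /coord_pi !piE. Qed.

Lemma coord_pi0 X : coord_pi X 0 = 0.
Proof. by rewrite /coord_pi !piE. Qed.

Lemma coord_piK X (a : coord X) : coord_pi X (repr a) = a.
Proof. exact: reprK. Qed.

Lemma coord_mulA X : associative (@coord_mul X).
Proof.
move=> a b c; rewrite -(coord_piK a) -(coord_piK b) -(coord_piK c).
by rewrite !coord_mulE mulrA.
Qed.

Lemma coord_mulC X : commutative (@coord_mul X).
Proof. by move=> a b; rewrite /coord_mul mulrC. Qed.

Lemma coord_mul1 X : left_id (coord_one X) (@coord_mul X).
Proof. by move=> a; rewrite -(coord_piK a) coord_mulE mul1r. Qed.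

Lemma coord_mulD X : left_distributive (@coord_mul X) +%R.
Proof.
move=> a b c; rewrite -(coord_piK a) -(coord_piK b) -(coord_piK c).
by rewrite coord_addE !coord_mulE coord_addE mulrDl.
Qed.

HB.instance Definition _ X := GRing.Zmodule_isComPzRing.Build (coord X)
  (@coord_mulA X) (@coord_mulC X) (@coord_mul1 X) (@coord_mulD X).

Lemma coord_piM X f g : coord_pi X (f * g) = coord_pi X f * coord_pi X g.
Proof. by rewrite -coord_mulE. Qed.

Lemma coord_pi1 X : coord_pi X 1 = 1.
Proof. by []. Qed.

Definition x0 X : coord X := coord_pi X 'X_ord0.
Definition coord_const X (c : K) : coord X := coord_pi X c%:MP.

Definition coord_deg X (d : nat) : set (coord X) :=
  [set a | exists2 f : P, f \is d.-homog & a = coord_pi X f].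

Definition coord_degz X (d : int) : set (coord X) :=
  match d with Posz k => coord_deg k | Negz _ => [set 0] end.

(* The direct sum of the R_i with i >= d. *)
Definition coord_ge X (d : nat) : set (coord X) :=
  [set a | exists2 f : P, {in msupp f, forall m, (d <= mdeg m)%N}
                        & a = coord_pi X f].

Definition coord_comp X (d : nat) (a : coord X) : coord X :=
  coord_pi X (pihomog mdeg d (repr a)).

Lemma coord_deg1 X : coord_deg 0 (1 : coord X).
Proof. by exists 1; [exact: dhomog1 | rewrite coord_pi1]. Qed.

Lemma coord_degM X d e (a b : coord X) :
  coord_deg d a -> coord_deg e b -> coord_deg (d + e)%N (a * b).
Proof.
move=> [f hf ->] [g hg ->]; exists (f * g); first exact: dhomogM.
by rewrite coord_piM.
Qed.

(* For a multiplicative set S of homogeneous elements of R, the homogeneous   *)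
(* elements of degree d of the localization of R at S.                        *)
Definition loc_deg X (S : mulset (coord X)) (d : int) : set (loc S) :=
  [set x | exists a b (f s : coord X),
     [/\ coord_deg a f, coord_deg b s, S s, d = a%:Z - b%:Z
       & x = loc_frac S f s]].

Definition off_point X p (s : coord X) : Prop :=
  exists d (f : P), [/\ f \is d.-homog, f \notin pid p & s = coord_pi X f].

Lemma pid1 p : 1 \notin pid p.
Proof.
apply/negP => p1; have [_ _ IM _] := pid_homog p.
have [i /negP[]] := pid_relevant p.
by rewrite -['X_i]mulr1; exact: IM.
Qed.

Lemma off_point1 X p : off_point p (1 : coord X).
Proof. by exists 0%N, 1; rewrite dhomog1 pid1. Qed.

Lemma off_pointM X p (s t : coord X) :
  off_point p s -> off_point p t -> off_point p (s * t).
Proof.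
move=> [d [f [hf fp ->]]] [e [g [hg gp ->]]]; exists (d + e)%N, (f * g).
rewrite dhomogM // coord_piM; split=> //.
by apply/negP => /pid_prime[|]; apply/negP.
Qed.

Definition off_mulset X p := Mulset (off_point1 X p) (@off_pointM X p).

(* The local ring of X at a point p of P^n is the degree 0 part of the        *)
(* localization of R at its homogeneous elements outside p; it is the zero    *)
(* ring if p is not on X.                                                     *)
Definition stalk_pred X p : {pred loc (off_mulset X p)} :=
  fun x => `[< loc_deg 0 x >].

Lemma loc_frac_pi (A : comPzRingType) (S : mulset A) a s (Ss : S s) :
  loc_frac S a s = \pi_(loc S) (Fracpair a Ss).
Proof.
rewrite /loc_frac; case: pselect => // Ss'; congr (\pi_(loc S) _).
by congr Fracpair; exact: Prop_irrelevance.
Qed.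

Lemma stalk_subring X p : subring_closed (@stalk_pred X p).
Proof.
have hom0 a b : 0 = a%:Z - b%:Z -> a = b.
  by move=> /esym/eqP; rewrite subr_eq0 => /eqP[].
split=> [|x y|x y].
- apply/asboolP; exists 0%N, 0%N, 1, 1; split; rewrite ?subrr //.
  + exact: coord_deg1.
  + exact: coord_deg1.
  + exact: off_point1.
  + by rewrite (loc_frac_pi (S := off_mulset X p) _ (off_point1 X p)); apply: loc_ext => /=; ring.
- move=> /asboolP[a [b [_ [_ [[f hf ->] [s hs ->] Ss /hom0 e ->]]]]].
  move=> /asboolP[c [d [_ [_ [[g hg ->] [t ht ->] St /hom0 e' ->]]]]].
  subst b d; apply/asboolP.
  exists (a + c)%N, (a + c)%N, (coord_pi X (f * t - g * s)), (coord_pi X (s * t)).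
  split; rewrite ?subrr //.
  + exists (f * t - g * s) => //; apply: rpredB; first exact: dhomogM.
    by rewrite addnC dhomogM.
  + by exists (s * t) => //; exact: dhomogM.
  + by rewrite coord_piM; exact: off_pointM.
  + have Sst : off_mulset X p (coord_pi X (s * t)).
      by rewrite coord_piM; exact: off_pointM.
    rewrite (loc_frac_pi _ Ss) (loc_frac_pi _ St) (loc_frac_pi _ Sst).
    apply: etrans (congr1 (loc_add _) (loc_oppE _)) _.
    apply: etrans (loc_addE _ _) _; apply: loc_ext => /=.
    have -> : coord_pi X (f * t - g * s)
            = coord_pi X f * coord_pi X t - coord_pi X g * coord_pi X s.
      rewrite -!coord_piM; apply/eqP; rewrite eq_sym subr_eq coord_addE.
      by rewrite subrK.
    by rewrite coord_piM; ring.
- move=> /asboolP[a [b [_ [_ [[f hf ->] [s hs ->] Ss /hom0 e ->]]]]].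
  move=> /asboolP[c [d [_ [_ [[g hg ->] [t ht ->] St /hom0 e' ->]]]]].
  subst b d; apply/asboolP.
  exists (a + c)%N, (a + c)%N, (coord_pi X (f * g)), (coord_pi X (s * t)).
  split; rewrite ?subrr //.
  + by exists (f * g) => //; exact: dhomogM.
  + by exists (s * t) => //; exact: dhomogM.
  + by rewrite coord_piM; exact: off_pointM.
  + have Sst : off_mulset X p (coord_pi X (s * t)).
      by rewrite coord_piM; exact: off_pointM.
    rewrite (loc_frac_pi _ Ss) (loc_frac_pi _ St) (loc_frac_pi _ Sst).
    apply: etrans (loc_mulE _ _) _; apply: loc_ext => /=.
    by rewrite !coord_piM; ring.
Qed.

HB.instance Definition _ X p :=
  GRing.isSubringClosed.Build (loc (off_mulset X p)) (@stalk_pred X p)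
    (stalk_subring X p).

Record stalk X p := Stalk {
  stalk_val : loc (off_mulset X p);
  stalk_valP : stalk_val \in @stalk_pred X p
}.

HB.instance Definition _ X p := [isSub for @stalk_val X p].
HB.instance Definition _ X p := [Choice of stalk X p by <:].
HB.instance Definition _ X p :=
  GRing.SubChoice_isSubComPzRing.Build _ _ (stalk X p)
    (@stalk_subring X p).

(* The element f / s of the local ring, for f and s in some R_d, s off p. *)
Definition stalk_frac X p (f s : coord X) : stalk X p :=
  insubd 0 (loc_frac (off_mulset X p) f s).

Definition stalk_const X p (c : K) : stalk X p :=
  stalk_frac p (coord_const X c) 1.

(* The local ring at a point of the support, which is not the zero ring. *)
Definition lring X (p : supp X) := stalk X p.

HB.instance Definition _ X (p : supp X) := GRing.ComPzRing.on (lring p).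

Lemma lring_neq0 X (p : supp X) : 1 != 0 :> lring p.
Proof.
apply/eqP => /(congr1 val).
rewrite rmorph1 rmorph0 => e1.
have /loc_eqP : \pi_(loc (off_mulset X p)) (fp_embed _ 1)
              = \pi_(loc (off_mulset X p)) (fp_embed _ 0) by exact: e1.
move=> [u [d [f [hf fp ->]]]] /=.
rewrite !mulr1 mulr0 => e; have fI : f \in vid X.
  by have := etrans e (esym (coord_pi0 X)) => /coord_piP; rewrite subr0.
by have := supp_on p fI; rewrite (negPf fp).
Qed.

HB.instance Definition _ X (p : supp X) :=
  GRing.PzSemiRing_isNonZero.Build (lring p) (lring_neq0 p).

(* e is a K-basis of V modulo the subspace W of V, in a ring B that is a      *)
(* K-algebra through c : K -> B.                                              *)
Definition basis_mod (B : comPzRingType) (c : K -> B) (V W : set B)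
    (d : nat) (e : 'I_d -> B) : Prop :=
  (forall k, V (e k)) /\
  (forall v, V v ->
     exists! a : {ffun 'I_d -> K}, W (v - \sum_(k < d) c (a k) * e k)).

Definition dim_mod (B : comPzRingType) (c : K -> B) (V W : set B) : nat :=
  natmin (fun d => exists e : 'I_d -> B, basis_mod c V W e).

Definition hilbert X (i : nat) : nat :=
  dim_mod (@coord_const X) (@coord_deg X i) [set 0].

(* For X of dimension 0 the support is finite, so that this is the plain sum  *)
(* over all p in Supp(X).                                                     *)
Definition deg X : nat :=
  (\sum_(p \in [set: supp X])
     dim_mod (@stalk_const X p) setT [set 0%R : stalk X p])%N.

(* The values HF(i) for i < 0 are 0 and deg X > 0 for X of dimension 0, so    *)
(* the least such integer is a natural number.                                *)
Definition reg_index X : nat :=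
  natmin (fun r => forall i, (r <= i)%N -> hilbert X i = deg X).

Definition noetherian (B : comPzRingType) : Prop :=
  forall J : set B,
    J 0 -> (forall a b, J a -> J b -> J (a + b)) ->
    (forall a b, J b -> J (a * b)) ->
    exists m (g : 'I_m -> B), (forall k, J (g k)) /\
      forall b, J b -> exists a : 'I_m -> B, b = \sum_(k < m) a k * g k.

Definition injective_module (B : comPzRingType) (E : lmodType B) : Prop :=
  forall (M N : lmodType B) (i : {linear M -> N}) (f : {linear M -> E}),
    injective i -> exists g : {linear N -> E}, forall m, g (i m) = f m.

(* The injective dimension of M is at most d: there is an exact sequence      *)
(* 0 -> M -> E_0 -> ... -> E_d -> 0 with injective modules E_k.               *)
Fixpoint injdim_le (B : comPzRingType) (d : nat) (M : lmodType B) : Prop :=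
  match d with
  | 0%N => injective_module M
  | d'.+1 =>
    exists (E C : lmodType B) (i : {linear M -> E}) (s : {linear E -> C}),
      [/\ injective_module E, injective i,
          forall c, exists e, s e = c,
          forall e, s e = 0 <-> exists m, i m = e
        & injdim_le d' C]
  end.

(* A Noetherian local ring is Gorenstein if it has finite injective dimension *)
(* over itself.                                                               *)
Definition gorenstein_local (B : comPzRingType) : Prop :=
  noetherian B /\ exists d, injdim_le d (B^o : lmodType B).

Definition locally_gorenstein X : Prop :=
  forall p : supp X, gorenstein_local (stalk X p).

Definition hnzd X (s : coord X) : Prop :=
  (exists d, coord_deg d s) /\ (forall a : coord X, s * a = 0 -> a = 0).

Lemma hnzd1 X : hnzd (1 : coord X).
Proof. by split=> [|a]; [exists 0%N; exact: coord_deg1 | rewrite mul1r]. Qed.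

Lemma hnzdM X (s t : coord X) : hnzd s -> hnzd t -> hnzd (s * t).
Proof.
move=> [[d hs] ns] [[e ht] nt]; split; first by exists (d + e)%N; exact: coord_degM.
by move=> a; rewrite -mulrA => /ns /nt.
Qed.

Definition hnzd_mulset X := Mulset (hnzd1 X) (@hnzdM X).

Definition Qh X := loc (hnzd_mulset X).

Definition toQh X (a : coord X) : Qh X := to_loc (hnzd_mulset X) a.

Definition Qh_deg X (d : int) : set (Qh X) := @loc_deg X (hnzd_mulset X) d.

(* The subrings K[x_0] of R and L_0 = K[x_0, x_0^-1] of Q^h(R); the latter is *)
(* meaningful when x_0 is a non-zerodivisor.                                  *)
Definition Kx0 X : set (coord X) :=
  [set a | exists f : {poly K},
     a = \sum_(i < size f) coord_const X f`_i * x0 X ^+ i].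

Definition L0 X : set (Qh X) :=
  [set q | exists (k : nat) (a : coord X),
     Kx0 a /\ q = loc_frac (hnzd_mulset X) a (x0 X ^+ k)].

(* Homogeneous elements of degree d of the graded module Hom_L(B, L), where   *)
(* B is a ring with homogeneous components G i, and L is a graded subring.    *)
Definition hom_deg (B : comPzRingType) (G : int -> set B) (L : set B)
    (d : int) (phi : B -> B) : Prop :=
  [/\ forall a, L (phi a),
      forall a b, phi (a + b) = phi a + phi b,
      forall l a, L l -> phi (l * a) = l * phi a
    & forall i a, G i a -> G (i + d) (phi a)].

Definition graded_hom (B : comPzRingType) (G : int -> set B) (L : set B)
    (phi : B -> B) : Prop :=
  exists m (d : 'I_m -> int) (psi : 'I_m -> B -> B),
    (forall k, hom_deg G L (d k) (psi k)) /\
    (forall a, phi a = \sum_(k < m) psi k a).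

(* The product g sigma is the homomorphism q |-> sigma (g q).                 *)
Definition trace_map X (sigma : Qh X -> Qh X) : Prop :=
  hom_deg (@Qh_deg X) (@L0 X) 0 sigma /\
  forall phi, graded_hom (@Qh_deg X) (@L0 X) phi ->
    exists! g : Qh X, forall q, phi q = sigma (g * q).

(* psi is the extension of phi in Hom_{K[x_0]}(R, K[x_0]) to an element of    *)
(* Hom_{L_0}(Q^h(R), L_0).                                                    *)
Definition hom_extension X (phi : coord X -> coord X) (psi : Qh X -> Qh X) :=
  [/\ graded_hom (@coord_degz X) (@Kx0 X) phi,
      graded_hom (@Qh_deg X) (@L0 X) psi
    & forall a, psi (toQh a) = toQh (phi a)].

Definition dedekind_compl X (sigma : Qh X -> Qh X) : set (Qh X) :=
  [set g | exists phi psi, hom_extension phi psi /\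
                           forall q, psi q = sigma (g * q)].

Definition dedekind_different X (sigma : Qh X -> Qh X) : set (Qh X) :=
  [set f | forall g, dedekind_compl sigma g ->
             exists a : coord X, f * g = toQh a].

Definition minimal_dedekind_different X (sigma : Qh X -> Qh X) : Prop :=
  dedekind_different sigma = @toQh X @` coord_ge (2 * reg_index X).

(* The germ a / x_0^i of a in R_i, when p is not on the hyperplane X_0 = 0.   *)
Definition germ X (p : supp X) (i : nat) (a : coord X) : lring p :=
  stalk_frac p a (x0 X ^+ i).

(* The product over Supp(X) of the polynomial rings over the local rings,     *)
(* with componentwise operations, and the embedding of R into it.             *)
Definition Rtilde X := forall p : supp X, {poly lring p}.

Definition Rtilde_mul X (f g : Rtilde X) : Rtilde X :=
  fun p : supp X => f p * g p.

Definition itilde X (a : coord X) : Rtilde X :=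
  fun p : supp X => \poly_(i < msize (repr a)) germ p i (coord_comp i a).

Definition conductor X : set (Rtilde X) :=
  [set f | forall g, exists a : coord X, Rtilde_mul f g = itilde a].

(* The square of the conductor, which is an ideal both of R~ and of R; the    *)
(* products over the two rings are the same.                                  *)
Definition conductor_sq X : set (coord X) :=
  [set a | exists m (f g : 'I_m -> coord X),
     [/\ forall k, conductor (itilde (f k)), forall k, conductor (itilde (g k))
       & a = \sum_(k < m) f k * g k]].

Definition nonunit (B : comPzRingType) : set B :=
  [set a | ~ exists b, a * b = 1].

(* The residue field of the local ring at p is its quotient by the nonunits.  *)
Definition resdeg X (p : supp X) : nat :=
  dim_mod (@stalk_const X p) setT (@nonunit (stalk X p)).

(* The canonical map from the local ring of X at p to that of Y, for a        *)
(* subscheme Y of X: it sends the germ of f / s to the germ of f / s.         *)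
Definition stalk_map X Y p (x : stalk X p) : stalk Y p :=
  stalk_frac p (coord_pi Y (repr (num (repr (val x)))))
               (coord_pi Y (repr (den (repr (val x))))).

Definition point_subscheme X (p : supp X) Y : Prop :=
  [/\ subscheme Y X,
      forall q : supp X, q <> p -> bijective (@stalk_map X Y q)
    & forall y : stalk Y p, exists x, @stalk_map X Y p x = y].

Definition maximal_point_subscheme X (p : supp X) Y : Prop :=
  point_subscheme p Y /\ (deg Y + resdeg p)%N = deg X.

(* s is a nonzero socle element generating the kernel of the canonical map    *)
(* from the local ring of X at p to that of Y.                                *)
Definition socle_generator X (p : supp X) Y (s : lring p) : Prop :=
  [/\ s != 0,
      forall a : lring p, nonunit a -> a * s = 0
    & forall a : lring p, @stalk_map X Y p a = 0 <-> exists b, a = b * s].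

Definition mu X (p : supp X) (a : lring p) : nat :=
  natmin (fun i => exists f : coord X,
    itilde f p = a *: 'X^i /\ forall q, q <> p -> itilde f q = 0).

(* m is the value of mu_{Y/X}, computed with the socle generator s and a      *)
(* family e whose residue classes form a K-basis of the residue field.        *)
Definition mu_subscheme X (p : supp X) Y (m : nat) : Prop :=
  exists (s : lring p) (e : 'I_(resdeg p) -> lring p),
    [/\ socle_generator Y s,
        basis_mod (@stalk_const X p) setT (@nonunit (stalk X p)) e
      & m = (\max_(k < resdeg p) mu (e k * s)%R)%N].

Definition degree_at X (p : supp X) : nat :=
  natmin (fun m => exists2 Y, maximal_point_subscheme p Y
                            & mu_subscheme p Y m).

Definition cayley_bacharach X : Prop :=
  forall p : supp X, degree_at p = reg_index X.

End Scheme.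

Arguments toQh {K n} X a.
Arguments conductor_sq {K n} X.
Arguments cayley_bacharach {K n} X.

(* Main.v *)
From HB Require Import structures.
Require Import Defs.
From mathcomp Require Import all_boot all_order all_algebra mpoly.
From mathcomp Require Import ring zify.
From mathcomp Require Import boolp classical_sets fsbigop.
Import Defs.

(* Let S be the degree 0 part of R_{x_0}, filtered by F_i = x_0^{-i} R_i.     *)
(* The ring S is finite-dimensional, it is the product of the local rings of  *)
(* X, and r_X is the least i with F_i = S.  The component of degree i of the  *)
(* conductor is the largest ideal of S contained in F_i, and deg_X(p) is the  *)
(* least i such that F_i contains a nonzero ideal of S supported at p.  Hence *)
(* X is a Cayley-Bacharach scheme iff F_{r-1} contains no nonzero ideal, and  *)
(* then the conductor is R_{>= r} and its square is R_{>= 2r}; this gives one *)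
(* implication.  Conversely, if S t is contained in F_{r-1} then t x_0^{2r-1} *)
(* lies in the different, because the complementary module lives in degrees   *)
(* >= -r; so t = 0 when the different is minimal.                             *)

Set Implicit Arguments.
Unset Strict Implicit.
Unset Printing Implicit Defensive.

Import Order.TTheory GRing.Theory.
Local Open Scope ring_scope.
Local Open Scope quotient_scope.
Local Open Scope classical_set_scope.

(** * Dimensions of quotients of subspaces *)

(** Every notion of the theorem is translated into the finite-dimensional algebra S = [aff X] with
    its increasing filtration F_i = [filt i]. No point of X lies on X_0 = 0, so saturation makes x_0
    a non-zerodivisor ([x0_regular]), and R_{d+1} = x_0 R_d for large d ([coord_deg_generated]).
    Thus F_i is a copy of R_i, and F_i = S for large i. Idempotents ([fitting_idempotent]) split S
    into the local rings ([rho_inj], [rho_joint_surj]). Hence dim S = deg X, and F_i = S exactly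
    when i >= r ([aff_dim], [filt_reg]).

    A nonzero ideal inside F_j contains a nonzero socle element t at some point p ([socle_exists]).
    The ideal St defines a maximal p-subscheme ([socle_scheme_maximal]), whose mu is the least i
    with St inside F_i ([mu_subscheme_filt]). So X is Cayley-Bacharach iff F_j contains no nonzero
    ideal for j < r ([cayley_bacharach_filt]). In that case the conductor is R_{>=r}, and its square
    is R_{>=2r} because R_{r+i} = x_0^r R_i for i >= r ([conductor_sq_ge]). For such X, minimality
    of the different is therefore the equality of the different with the squared conductor.

    It remains to obtain the condition on ideals from minimality. Let g be in the complementary
    module. Since S x_0^r = R_r, the trace of g S x_0^r lies in K[x_0], and nondegeneracy of the
    trace kills the components of g of degree < -r ([dedekind_compl_low]). If St lies in F_j with j
    < r, then t x_0^{2r-1} g has its components in St x_0^d with d >= r-1 >= j, hence lies in R. So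
    t x_0^{2r-1} is an element of the different of degree below 2r ([ideal_in_different]), and t =
    0. *)

Lemma natminP (Q : nat -> Prop) : (exists k, Q k) -> Q (natmin Q).
Proof.
rewrite /natmin => -[k Qk]; case: pselect => [h|[]]; last first.
  by exists k; apply/asboolP.
by case: ex_minnP => m /asboolP.
Qed.

Lemma natmin_le (Q : nat -> Prop) k : Q k -> (natmin Q <= k)%N.
Proof.
move=> Qk; rewrite /natmin; case: pselect => // h.
by case: ex_minnP => m _; apply; apply/asboolP.
Qed.

Lemma natmin_eq (Q : nat -> Prop) k :
  Q k -> (forall l, Q l -> (k <= l)%N) -> natmin Q = k.
Proof.
move=> Qk min; apply/eqP; rewrite eqn_leq natmin_le //=.
by apply: min; apply: natminP; exists k.
Qed.

Section Dimension.
Variables (K : fieldType) (B : comPzRingType) (c : {rmorphism K -> B}).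
Implicit Types (U V W : set B).

Definition subspace U : Prop :=
  [/\ U 0, forall u v, U u -> U v -> U (u + v) & forall a u, U u -> U (c a * u)].

Definition lincomb d (a : 'I_d -> K) (e : 'I_d -> B) : B :=
  \sum_(k < d) c (a k) * e k.

Definition spanning V W d (e : 'I_d -> B) : Prop :=
  forall v, V v -> exists a : 'I_d -> K, W (v - lincomb a e).

Definition free_mod W d (e : 'I_d -> B) : Prop :=
  forall a : 'I_d -> K, W (lincomb a e) -> forall k, a k = 0.

Lemma subspaceN U u : subspace U -> U u -> U (- u).
Proof. by case=> _ _ UZ /(UZ (-1)); rewrite rmorphN1 mulN1r. Qed.

Lemma subspaceB U u v : subspace U -> U u -> U v -> U (u - v).
Proof. by move=> sU Uu Uv; case: (sU) => _ + _; apply=> //; exact: subspaceN. Qed.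

Lemma subspace_sum U (I : Type) (r : seq I) (P : pred I) (F : I -> B) :
  subspace U -> (forall i, P i -> U (F i)) -> U (\sum_(i <- r | P i) F i).
Proof. by case=> U0 UD _ UF; elim/big_ind: _. Qed.

Lemma subspace_lincomb U d (a : 'I_d -> K) e :
  subspace U -> (forall k, U (e k)) -> U (lincomb a e).
Proof. by move=> sU Ue; apply: subspace_sum => // k _; case: sU => _ _; apply. Qed.

Lemma subspace0 : subspace [set 0].
Proof.
by split=> //= [u v -> ->|a u ->]; rewrite ?addr0 ?mulr0.
Qed.

Lemma subspaceT : subspace setT.
Proof. by split. Qed.

Lemma lincombB d (a b : 'I_d -> K) e :
  lincomb a e - lincomb b e = lincomb (fun k => a k - b k) e.
Proof. by rewrite /lincomb -sumrB; apply: eq_bigr => k _; rewrite rmorphB mulrBl. Qed.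

(** Uniqueness of the coordinates of 0 is freeness modulo W; differences reduce the general case to
    this one. *)
Lemma basis_modP V W d (e : 'I_d -> B) : subspace V -> subspace W ->
  basis_mod c V W e <-> [/\ forall k, V (e k), spanning V W e & free_mod W e].
Proof.
move=> sV sW; split=> [[Ve bas]|[Ve span free]].
  split=> // [v /bas[a [Wa _]]|a Wa k]; first by exists a.
  have V0 : V 0 by case: sV.
  have [a0 [_ uniq]] := bas 0 V0.
  have /(uniq _)/ffunP/(_ k) : W (0 - \sum_(k < d) c ([ffun k => - a k] k) * e k).
    rewrite (_ : _ - _ = lincomb a e) // sub0r -sumrN; apply: eq_bigr => j _.
    by rewrite ffunE rmorphN mulNr opprK.
  have /(uniq _)/ffunP/(_ k) : W (0 - \sum_(k < d) c ([ffun=> 0] k) * e k).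
    rewrite big1 ?subr0; first by case: sW.
    by move=> j _; rewrite ffunE rmorph0 mul0r.
  by rewrite !ffunE => -> /eqP; rewrite eq_sym oppr_eq0 => /eqP.
split=> // v /span[a Wa]; exists [ffun k => a k]; split.
  rewrite (_ : \sum_(k < d) _ = lincomb a e) //.
  by apply: eq_bigr => k _; rewrite ffunE.
move=> b Wb; apply/ffunP=> k; rewrite ffunE.
have /free/(_ k)/eqP : W (lincomb (fun k => a k - b k) e).
  rewrite -lincombB (_ : _ - _ = v - lincomb b e - (v - lincomb a e)).
    exact: subspaceB.
  by ring.
by rewrite subr_eq0 => /eqP.
Qed.

(** If m > d, the m x d matrix of coordinates of f in terms of e has a nonzero vector in its left
    kernel, which is a relation among the f modulo W. *)
Lemma free_le_spanning V W d m (e : 'I_d -> B) (f : 'I_m -> B) : subspace W ->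
  spanning V W e -> (forall k, V (f k)) -> free_mod W f -> (m <= d)%N.
Proof.
move=> sW span Vf free; rewrite leqNgt; apply/negP => ltdm.
have /choice[M MP] k : exists a : 'I_d -> K, W (f k - lincomb a e) by exact: span.
pose A : 'M[K]_(m, d) := \matrix_(k, j) M k j.
have /rowV0Pn[u /sub_kermxP uA u0] : kermx A != 0.
  by rewrite -mxrank_eq0 mxrank_ker subn_eq0 -ltnNge (leq_ltn_trans (rank_leq_col A)).
case/eqP: u0; apply/rowP => k; rewrite mxE; apply: (free (u 0)).
have -> : lincomb (u 0) f =
          \sum_k c (u 0 k) * (f k - lincomb (M k) e) + \sum_k c (u 0 k) * lincomb (M k) e.
  by rewrite -big_split; apply: eq_bigr => i _ /=; ring.
have -> : \sum_k c (u 0 k) * lincomb (M k) e = 0.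
  under eq_bigr do rewrite mulr_sumr.
  rewrite exchange_big big1 // => j _.
  transitivity (c ((u *m A) 0 j) * e j); last by rewrite uA mxE rmorph0 mul0r.
  rewrite mxE rmorph_sum mulr_suml; apply: eq_bigr => i _.
  by rewrite mxE rmorphM mulrA.
rewrite addr0; apply: subspace_sum => // i _.
by case: sW => _ _; apply; exact: MP.
Qed.

(** The spanning family need not lie in V, so the property passes to smaller V with the same
    family. *)
Definition finite_mod V W : Prop :=
  exists D (e : 'I_D -> B), spanning V W e.

Lemma finite_mod_sub V V' W W' : V' `<=` V -> W `<=` W' -> subspace W' ->
  finite_mod V W ->
  exists D, forall m (f : 'I_m -> B), (forall k, V' (f k)) -> free_mod W' f ->
    (m <= D)%N.
Proof.
move=> VV WW sW' [D [e span]]; exists D => m f Vf free.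
apply: (@free_le_spanning V' W' _ _ e f) => // v /VV/span[a Wa].
by exists a; exact: WW.
Qed.

(** A free family of maximal length spans: a vector outside its span could be adjoined. *)
Lemma basis_exists V V' W W' : V' `<=` V -> W `<=` W' ->
  subspace V' -> subspace W' -> finite_mod V W ->
  exists d (e : 'I_d -> B), basis_mod c V' W' e.
Proof.
move=> VV WW sV sW /(finite_mod_sub VV WW sW)[D bound].
pose Q m := `[< exists f : 'I_m -> B, (forall k, V' (f k)) /\ free_mod W' f >].
have Q0 : exists m, Q m.
  by exists 0%N; apply/asboolP; exists (fun=> 0); split=> [[]|a _ []].
have QD m : Q m -> (m <= D)%N by move=> /asboolP[f [Vf free]]; exact: bound.
case: (ex_maxnP Q0 QD) => d /asboolP[e [Ve free]] maxd.
exists d, e; apply/basis_modP => //; split=> // v Vv; apply: contrapT => nspan.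
suff /maxd : Q d.+1 by rewrite ltnn.
apply/asboolP; pose f (k : 'I_d.+1) := if unlift ord0 k is Some j then e j else v.
exists f; split=> [k|a Wa].
  by rewrite /f; case: unliftP.
have aE : lincomb a f = c (a ord0) * v + lincomb (a \o lift ord0) e.
  rewrite /lincomb big_ord_recl /f unlift_none; congr (_ + _).
  by apply: eq_bigr => j _; rewrite liftK.
have [a0|a0] := eqVneq (a ord0) 0.
  move=> k; case: (unliftP ord0 k) => [j|] -> //.
  apply: (free (a \o lift ord0)).
  by move: Wa; rewrite aE a0 rmorph0 mul0r add0r.
case: nspan; exists (fun j => - (a ord0)^-1 * a (lift ord0 j)).
have -> : v - lincomb (fun j => - (a ord0)^-1 * a (lift ord0 j)) e
        = c (a ord0)^-1 * lincomb a f.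
  rewrite aE mulrDr mulrA -rmorphM mulVf // rmorph1 mul1r; congr (_ + _).
  rewrite /lincomb mulr_sumr -sumrN; apply: eq_bigr => j _.
  by rewrite /= rmorphM rmorphN -mulrA mulNr opprK.
by case: sW => _ _; apply.
Qed.

Lemma dim_modE V W d (e : 'I_d -> B) : subspace V -> subspace W ->
  basis_mod c V W e -> dim_mod c V W = d.
Proof.
move=> sV sW be; apply: natmin_eq; first by exists e.
move=> m [f bf]; have [_ span _] := iffLR (basis_modP f sV sW) bf.
by have [Ve _ free] := iffLR (basis_modP e sV sW) be; exact: (free_le_spanning sW span Ve free).
Qed.

Lemma dim_mod_basis V W : subspace V -> subspace W -> finite_mod V W ->
  exists e : 'I_(dim_mod c V W) -> B, basis_mod c V W e.
Proof.
move=> sV sW /basis_exists-/(_ _ _ (@subset_refl _ _) (@subset_refl _ _) sV sW)[d [e be]].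
by apply: (natminP (Q := fun d => exists e : 'I_d -> B, basis_mod c V W e)); exists d, e.
Qed.

Lemma finite_modS V V' W W' : V' `<=` V -> W `<=` W' ->
  subspace V' -> subspace W' -> finite_mod V W -> finite_mod V' W'.
Proof.
move=> VV WW sV sW fin; have [d [e be]] := basis_exists VV WW sV sW fin.
by exists d, e; case/basis_modP: be.
Qed.

(** A basis of V modulo U followed by a basis of U modulo W is a basis of V modulo W. *)
Lemma dim_modD V U W : W `<=` U -> U `<=` V ->
  subspace V -> subspace U -> subspace W -> finite_mod V W ->
  dim_mod c V W = (dim_mod c V U + dim_mod c U W)%N.
Proof.
move=> WU UV sV sU sW fin.
have [e be] := dim_mod_basis sV sU (finite_modS (@subset_refl _ V) WU sV sU fin).
have [f bf] := dim_mod_basis sU sW (finite_modS UV (@subset_refl _ W) sU sW fin).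
move: e f be bf; set m := dim_mod c V U; set d := dim_mod c U W => e f.
move=> /basis_modP-/(_ sV sU)[Ve spane freee].
move=> /basis_modP-/(_ sU sW)[Uf spanf freef].
pose g (k : 'I_(m + d)) := match split k with inl i => e i | inr j => f j end.
have gE a : lincomb a g = lincomb (a \o @lshift m d) e + lincomb (a \o @rshift m d) f.
  rewrite /lincomb big_split_ord; congr (_ + _); apply: eq_bigr => i _.
    by rewrite /g (unsplitK (inl i)).
  by rewrite /g (unsplitK (inr i)).
apply: (@dim_modE V W _ g) => //; apply/basis_modP => //; split.
- by move=> k; rewrite /g; case: (split k) => i //; exact: UV.
- move=> v /spane[a /spanf[b Wab]].
  exists (fun k => match split k with inl i => a i | inr j => b j end).
  move: Wab; rewrite gE -addrA -opprD; congr (W (_ - (_ + _))); apply: eq_bigr => i _ /=.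
    by rewrite (unsplitK (inl i)).
  by rewrite (unsplitK (inr i)).
- move=> a Wa.
  have Ua : U (lincomb (a \o @lshift m d) e).
    rewrite (_ : lincomb _ e = lincomb a g - lincomb (a \o @rshift m d) f).
      by apply: subspaceB => //; [exact: WU|exact: subspace_lincomb].
    by rewrite gE addrK.
  have a0 := freee _ Ua.
  have Wb : W (lincomb (a \o @rshift m d) f).
    move: Wa; rewrite gE [X in X + _]big1 ?add0r // => i _.
    by rewrite a0 rmorph0 mul0r.
  by move=> k; case: (split_ordP k) => i ->; [exact: a0|exact: (freef _ Wb)].
Qed.

Lemma dim_mod0 V W : subspace V -> subspace W -> finite_mod V W ->
  dim_mod c V W = 0%N -> V `<=` W.
Proof.
move=> sV sW fin d0; have [e] := dim_mod_basis sV sW fin.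
move=> /basis_modP-/(_ sV sW)[_ span _] v /span[a].
rewrite /lincomb; move: (e) a; rewrite d0 => e' a.
by rewrite big_ord0 subr0.
Qed.

Lemma dim_modxx V : subspace V -> dim_mod c V V = 0%N.
Proof.
move=> sV; apply: (@dim_modE V V 0 (fun=> 0)) => //.
apply/basis_modP => //; split=> [[]//|v Vv|a _ []//].
by exists (fun=> 0); rewrite /lincomb big_ord0 subr0.
Qed.

End Dimension.

(** * Comparison of dimensions along linear correspondences *)

Section Transfer.
Variables (K : fieldType) (B B' : comPzRingType).
Variables (c : {rmorphism K -> B}) (c' : {rmorphism K -> B'}).
Variable (T : B -> B' -> Prop).
Hypotheses (T0 : T 0 0)
  (TD : forall u u' v v', T u u' -> T v v' -> T (u + v) (u' + v'))
  (TZ : forall a u u', T u u' -> T (c a * u) (c' a * u')).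
Variables (V W : set B) (V' W' : set B').
Hypotheses (sV : subspace c V) (sW : subspace c W).
Hypotheses (sV' : subspace c' V') (sW' : subspace c' W').
Hypotheses (VV' : forall v, V v -> exists2 v', V' v' & T v v')
  (V'V : forall v', V' v' -> exists2 v, V v & T v v')
  (WW' : forall v v', T v v' -> W v <-> W' v').

Lemma transfer_lincomb d (a : 'I_d -> K) e e' :
  (forall k, T (e k) (e' k)) -> T (lincomb c a e) (lincomb c' a e').
Proof.
move=> Te; rewrite /lincomb; elim/big_ind2: _ => [|u u' v v'|k _] //.
  exact: TD.
exact: TZ.
Qed.

(** The isomorphism between V/W and V'/W' is given by a relation T, because the comparisons made
    below, such as that of a fraction with its numerator, need not be functions on the whole
    ring. *)
Lemma transfer_basis d (e : 'I_d -> B) : basis_mod c V W e ->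
  exists e' : 'I_d -> B', basis_mod c' V' W' e'.
Proof.
move=> /basis_modP-/(_ sV sW)[Ve span free].
have /choice[e' e'P] k : exists v', V' v' /\ T (e k) v'.
  by have [v' ? ?] := VV' (Ve k); exists v'.
have Te k := proj2 (e'P k); have Ve' k := proj1 (e'P k).
exists e'; apply/basis_modP => //; split=> // [v' /V'V[v Vv Tv]|a Wa].
  have [a Wa] := span v Vv; exists a; apply: iffLR (WW' _) Wa.
  apply: TD => //; have := TZ (-1) (transfer_lincomb a Te).
  by rewrite !rmorphN1 !mulN1r.
by apply: free; apply: iffRL (WW' _) Wa; exact: transfer_lincomb.
Qed.

Lemma transfer_finite : finite_mod c V W -> finite_mod c' V' W'.
Proof.
move=> fin; have [e be] := dim_mod_basis sV sW fin.
by have [e' /basis_modP-/(_ sV' sW')[]] := transfer_basis be; exists (dim_mod c V W), e'.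
Qed.

End Transfer.

Lemma transfer_dim (K : fieldType) (B B' : comPzRingType)
    (c : {rmorphism K -> B}) (c' : {rmorphism K -> B'}) (T : B -> B' -> Prop) V W V' W' :
  T 0 0 -> (forall u u' v v', T u u' -> T v v' -> T (u + v) (u' + v')) ->
  (forall a u u', T u u' -> T (c a * u) (c' a * u')) ->
  subspace c V -> subspace c W -> subspace c' V' -> subspace c' W' ->
  (forall v, V v -> exists2 v', V' v' & T v v') ->
  (forall v', V' v' -> exists2 v, V v & T v v') ->
  (forall v v', T v v' -> W v <-> W' v') ->
  dim_mod c V W = dim_mod c' V' W'.
Proof.
move=> T0 TD TZ sV sW sV' sW' VV' V'V WW'; congr natmin.
apply/funext => d; apply/propext; split=> -[e be].
  exact: (transfer_basis (T := T)) be.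
apply: (transfer_basis (T := fun x y => T y x)) be => // [u u' v v'|a u u'|v v' /WW'].
- exact: TD.
- exact: TZ.
- exact: iff_sym.
Qed.

(** * Localizations and homogeneous parts *)

Section LocalizationTheory.
Variables (A : comPzRingType) (S : mulset A).

Lemma to_locE a : to_loc S a = \pi_(loc S) (fp_embed S a).
Proof. exact: loc_frac_pi. Qed.

Lemma to_loc_zmod_morphism : zmod_morphism (to_loc S).
Proof.
move=> a b; rewrite !to_locE.
apply: esym; apply: etrans (congr1 (loc_add _) (loc_oppE _)) _.
by apply: etrans (loc_addE _ _) _; apply: loc_ext => /=; ring.
Qed.

Lemma to_loc_monoid_morphism : monoid_morphism (to_loc S).
Proof.
split=> [|a b]; first exact: to_locE.
rewrite !to_locE; apply: esym.
by apply: etrans (loc_mulE _ _) _; apply: loc_ext => /=; ring.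
Qed.

HB.instance Definition _ :=
  GRing.isZmodMorphism.Build A (loc S) (to_loc S) to_loc_zmod_morphism.
HB.instance Definition _ :=
  GRing.isMonoidMorphism.Build A (loc S) (to_loc S) to_loc_monoid_morphism.

Lemma to_loc_eq0 a : to_loc S a = 0 <-> exists2 u, S u & u * a = 0.
Proof.
rewrite to_locE (_ : 0 = \pi_(loc S) (fp_embed S 0)) // loc_eqP /=.
by split=> -[u Su b]; exists u => //; move: b; rewrite ?mulr1 ?mulr0.
Qed.

Lemma loc_fracK a s : S s -> loc_frac S a s * to_loc S s = to_loc S a.
Proof.
move=> Ss; rewrite (loc_frac_pi _ Ss) !to_locE.
by apply: etrans (loc_mulE _ _) _; apply: loc_ext => /=; ring.
Qed.

Lemma to_loc_inv s : S s -> exists t, to_loc S s * t = 1.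
Proof.
by move=> Ss; exists (loc_frac S 1 s); rewrite mulrC loc_fracK // rmorph1.
Qed.

Lemma to_loc_cancel s x y : S s -> x * to_loc S s = y * to_loc S s -> x = y.
Proof.
move=> /to_loc_inv[t st] /(congr1 ( *%R^~ t)).
by rewrite -!mulrA st !mulr1.
Qed.

(** Characterizing a fraction by this equation replaces computations with representatives of
    classes. *)
Lemma loc_fracP a s x : S s -> x * to_loc S s = to_loc S a <-> x = loc_frac S a s.
Proof.
move=> Ss; split=> [e|->]; last exact: loc_fracK.
by apply: (to_loc_cancel Ss); rewrite e loc_fracK.
Qed.

Lemma fracpairK (x : loc S) :
  x * to_loc S (den (repr x)) = to_loc S (num (repr x)).
Proof.
apply/(loc_fracP _ _ (denP _)); rewrite (loc_frac_pi _ (denP _)) -{1}[x]reprK.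
by congr (\pi_(loc S) _); case: (repr x).
Qed.

End LocalizationTheory.

Section HomogeneousParts.
Variables (K : fieldType) (n : nat).
Local Notation P := {mpoly K[n.+1]}.
Implicit Types (X : pscheme K n) (f g : P).

Lemma pihomog_sum f k : (msize f <= k)%N -> f = \sum_(d < k) pihomog mdeg d f.
Proof. by move=> h; apply: pihomog_partitionE. Qed.

Lemma pihomog_ge f d : (msize f <= d)%N -> pihomog mdeg d f = 0.
Proof.
move=> h; rewrite (pihomogwE _ _ (leqnn (msize f))) big1 // => m /eqP md.
by have := bmdeg m; rewrite md ltnNge h.
Qed.

(** A form of degree d shifts components by d. The case e < d is separate because [e - d] is
    truncated. *)
Lemma pihomogM_homog d e f g : g \is d.-homog ->
  pihomog mdeg e (g * f) = if (d <= e)%N then g * pihomog mdeg (e - d) f else 0.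
Proof.
move=> hg; rewrite {1}(pihomog_sum (leqnn (msize f))) mulr_sumr raddf_sum.
have hom (i : nat) : g * pihomog mdeg i f \is (d + i).-homog.
  by apply: dhomogM => //; exact: pihomogP.
have hom0 (i : nat) : (d + i)%N != e -> pihomog mdeg e (g * pihomog mdeg i f) = 0.
  by move=> ne; apply: pihomog_ne0 ne (hom i).
case: leqP => [led|lted]; last by apply: big1 => i _; apply: hom0; lia.
have [lt|ge] := ltnP (e - d) (msize f).
  rewrite (bigD1 (Ordinal lt)) //= big1 => [|i ne].
    by rewrite addr0 pihomog_dE //; have := hom (e - d)%N; rewrite subnKC.
  by apply: hom0; apply: contraNneq ne => die; apply/eqP/val_inj => /=; lia.
rewrite (pihomog_ge ge) mulr0 big1 // => i _.
by apply: hom0; have := ltn_ord i; lia.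
Qed.

Lemma homog_idealP (I : P -> bool) f : homog_ideal I ->
  (forall d, I (pihomog mdeg d f)) -> I f.
Proof.
move=> [I0 ID _ _] If; rewrite (pihomog_sum (leqnn (msize f))).
by elim/big_ind: _ => //; exact: ID.
Qed.

End HomogeneousParts.

(** * Existence of points *)

Section Points.
Variables (K : fieldType) (n : nat).
Local Notation P := {mpoly K[n.+1]}.
Implicit Types (A : set P) (f g h : P).

Definition graded_ideal A : Prop :=
  [/\ forall f g, A f -> A g -> A (f + g), forall f g, A g -> A (f * g)
    & forall f d, A f -> A (pihomog mdeg d f)].

Lemma graded_idealN A f : graded_ideal A -> A f -> A (- f).
Proof. by case=> _ AM _ Af; rewrite -mulN1r; exact: AM. Qed.

(** Let f_d and g_e be the components of highest degree not in A. Modulo A, the component of degree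
    d + e of f g is f_d g_e, so primality for forms applies to it. *)
Lemma homog_prime A : graded_ideal A -> A 0 ->
  (forall d e f g, f \is d.-homog -> g \is e.-homog -> A (f * g) -> A f \/ A g) ->
  forall f g, A (f * g) -> A f \/ A g.
Proof.
move=> gA A0 prime f g Afg; apply: contrapT => /not_orP[nf ng].
have [AD AM AH] := gA.
have top h : ~ A h -> exists d, [/\ (d < msize h)%N, ~ A (pihomog mdeg d h)
    & forall e, (d < e)%N -> A (pihomog mdeg e h)].
  move=> nh; pose Q d := `[< ~ A (pihomog mdeg d h) >].
  have Q0 : exists d, Q d.
    apply: contrapT => Q0; apply: nh; rewrite (pihomog_sum (leqnn (msize h))).
    elim/big_ind: _ => // d _; apply: contrapT => nd; apply: Q0.
    by exists d; apply/asboolP.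
  have Qb d : Q d -> (d <= msize h)%N.
    rewrite leqNgt => /asboolP Qd; apply/negP => lt; apply: Qd.
    by rewrite pihomog_ge // ltnW.
  case: (ex_maxnP Q0 Qb) => d /asboolP nd maxd; exists d; split=> //.
    by rewrite ltnNge; apply/negP => ge; apply: nd; rewrite pihomog_ge.
  move=> e de; apply: contrapT => ne; have /maxd : Q e by apply/asboolP.
  by rewrite leqNgt de.
have [d [df nd maxd]] := top f nf; have [e [eg ne maxe]] := top g ng.
have := AH _ (d + e)%N Afg.
rewrite {1}(pihomog_sum (leqnn (msize f))) mulr_suml raddf_sum /=.
under eq_bigr => i _ do rewrite (pihomogM_homog _ _ (pihomogP mdeg i f)).
rewrite (bigD1 (Ordinal df)) //= leq_addr addKn.
set s := \sum_(i < _ | _) _ => Asum.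
have As : A s.
  rewrite /s; elim/big_ind: _ => // i ni; case: leqP => // _.
  have [lt|ge] := ltnP i d; first by apply: AM; apply: maxe; lia.
  rewrite mulrC; apply: AM; apply: maxd; rewrite ltn_neqAle ge andbT eq_sym.
  by apply: contraNneq ni => di; apply/eqP/val_inj.
have : A (pihomog mdeg d f * pihomog mdeg e g).
  by have := AD _ _ Asum (graded_idealN gA As); rewrite addrK.
by case/(prime _ _ _ _ (pihomogP mdeg d f) (pihomogP mdeg e g)).
Qed.

(* Zorn's lemma: a graded ideal maximal among those avoiding the powers of a  *)
(* variable is prime.                                                         *)
Lemma point_above (J : P -> bool) (i : 'I_n.+1) : homog_ideal J ->
  (forall k, ~~ J ('X_i ^+ k)) ->
  exists2 p : ppoint K n, {subset J <= pid p} & 'X_i \notin pid p.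
Proof.
move=> hJ nJ; have [J0 JD JM JH] := hJ.
pose good A := [/\ A = set0 \/ (J : set P) `<=` A, graded_ideal A
                 & forall k, ~ A ('X_i ^+ k)].
have [F Fgood tot|A [Agood maxA]] := @Zorn_bigcup P good.
  split.
  - have [->|/set0P[f fB]] := eqVneq (\bigcup_(B in F) B) set0; first by left.
    case: fB => C FC Cf; right => g Jg; exists C => //.
    by have [[C0|JC] _ _] := Fgood C FC; [rewrite C0 in Cf|exact: JC].
  - split=> [f g [B FB Bf] [C FC Cg]|f g [B FB Bg]|f d [B FB Bf]].
    + case: (tot B C FB FC) => sub.
        by exists C => //; have [_ [CD _ _] _] := Fgood C FC; apply: CD => //; exact: sub.
      by exists B => //; have [_ [BD _ _] _] := Fgood B FB; apply: BD => //; exact: sub.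
    + by exists B => //; have [_ [_ BM _] _] := Fgood B FB; exact: BM.
    + by exists B => //; have [_ [_ _ BH] _] := Fgood B FB; exact: BH.
  - by move=> k [B FB Bk]; have [_ _ /(_ k)] := Fgood B FB.
have Jgood : good (J : set P).
  by split; [right|split|move=> k /(elimN idP (nJ k))] => // f d; exact: JH.
have JA : (J : set P) `<=` A.
  case: Agood => -[A0 _ _|//]; case: (maxA _ _ Jgood); rewrite A0.
  by split=> // /(_ 0 J0).
have [_ gA nA] := Agood; have [AD AM AH] := gA.
have A0 : A 0 by exact: JA.
(* By maximality, A and a form outside A together generate some power of X_i. If f and g are two
   such forms with f g in A, the product of the two powers is in A, which is excluded. *)
have ext d h : h \is d.-homog -> ~ A h -> exists k a g, A a /\ 'X_i ^+ k = a + g * h.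
  move=> hh nh; apply: contrapT => nk.
  pose B : set P := [set f | exists a g, A a /\ f = a + g * h].
  have AB : A `<=` B by move=> a Aa; exists a, 0; rewrite mul0r addr0.
  apply: (maxA B).
    split=> // BA; apply: nh; apply: BA.
    by exists 0, 1; rewrite add0r mul1r.
  split; first by right => f /JA /AB.
    split=> [f1 f2 [a1 [g1 [Aa1 ->]]] [a2 [g2 [Aa2 ->]]]|f1 f2 [a2 [g2 [Aa2 ->]]]|f1 e].
    + by exists (a1 + a2), (g1 + g2); split; [exact: AD|ring].
    + by exists (f1 * a2), (f1 * g2); split; [exact: AM|ring].
    + move=> [a1 [g1 [Aa1 ->]]].
      exists (pihomog mdeg e a1), (if (d <= e)%N then pihomog mdeg (e - d) g1 else 0).
      split; first exact: AH.
      rewrite raddfD /= [g1 * h]mulrC (pihomogM_homog _ _ hh); congr (_ + _).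
      by case: ifP; rewrite ?mul0r // mulrC.
  by move=> k [a [g [Aa e]]]; apply: nk; exists k, a, g.
have prime : forall f g, A (f * g) -> A f \/ A g.
  apply: homog_prime => // d e f g hf hg Afg; apply: contrapT => /not_orP[nf ng].
  have [k [a [f' [Aa ek]]]] := ext _ _ hf nf.
  have [l [b [g' [Ab el]]]] := ext _ _ hg ng.
  apply: (nA (k + l)%N); rewrite exprD ek el.
  rewrite (_ : _ * _ = b * a + g' * g * a + f' * f * b + f' * g' * (f * g)); last by ring.
  by apply: (AD _ _ (AD _ _ (AD _ _ _ _) _) _); exact: AM.
have pgA : homog_ideal (fun f => `[< A f >]).
  split; first exact/asboolP.
  - by move=> f g /asboolP Af /asboolP Ag; apply/asboolP; exact: AD.
  - by move=> f g /asboolP Ag; apply/asboolP; exact: AM.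
  - by move=> f d /asboolP Af; apply/asboolP; exact: AH.
have pprime f g : f * g \in (fun f => `[< A f >]) ->
    f \in (fun f => `[< A f >]) \/ g \in (fun f => `[< A f >]).
  by move=> /asboolP/prime[Af|Ag]; [left|right]; apply/asboolP.
have nX : 'X_i \notin (fun f => `[< A f >]).
  by apply/asboolPn; have := nA 1%N; rewrite expr1.
exists (PPoint pgA pprime (ex_intro _ i nX)) => //.
by move=> f Jf; apply/asboolP; exact: JA.
Qed.

End Points.

(** * The homogeneous coordinate ring *)

Lemma dhomog_var (K : fieldType) (n : nat) (i : 'I_n) :
  ('X_i : {mpoly K[n]}) \is 1.-homog.
Proof. by rewrite dhomogX; apply/eqP; exact: mdeg1. Qed.

Section CoordinateRing.
Variables (K : fieldType) (n : nat) (X : pscheme K n).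
Local Notation P := {mpoly K[n.+1]}.
Local Notation R := (coord X).
Local Notation cpi := (coord_pi X).
Implicit Types (f g : P) (a b : R).

Lemma coord_pi_zmod_morphism : zmod_morphism cpi.
Proof.
move=> f g; apply/eqP; rewrite eq_sym subr_eq; apply/eqP.
by apply: esym; apply: etrans (coord_addE X (f - g) g) _; rewrite subrK.
Qed.

Lemma coord_pi_monoid_morphism : monoid_morphism cpi.
Proof. by split=> // f g; exact: coord_piM. Qed.

HB.instance Definition _ := GRing.isZmodMorphism.Build P R cpi coord_pi_zmod_morphism.
HB.instance Definition _ := GRing.isMonoidMorphism.Build P R cpi coord_pi_monoid_morphism.

Lemma coord_const_zmod_morphism : zmod_morphism (@coord_const K n X).
Proof. by move=> a b; rewrite /coord_const mpolyCB rmorphB. Qed.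

Lemma coord_const_monoid_morphism : monoid_morphism (@coord_const K n X).
Proof. by split=> [|a b]; rewrite /coord_const ?mpolyC1 ?mpolyCM ?rmorph1 ?rmorphM. Qed.

HB.instance Definition _ :=
  GRing.isZmodMorphism.Build K R (@coord_const K n X) coord_const_zmod_morphism.
HB.instance Definition _ :=
  GRing.isMonoidMorphism.Build K R (@coord_const K n X) coord_const_monoid_morphism.

Lemma coord_pi_eq0 f : cpi f = 0 <-> vid X f.
Proof. by rewrite -(coord_pi0 X) coord_piP subr0. Qed.

Lemma coord_degP d f : f \is d.-homog -> coord_deg d (cpi f).
Proof. by exists f. Qed.

Lemma coord_deg_subspace d : subspace (@coord_const K n X) (@coord_deg K n X d).
Proof.
split=> [|_ _ [f hf ->] [g hg ->]|c _ [f hf ->]].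
- by exists 0; rewrite ?dhomog0 ?rmorph0.
- by exists (f + g); rewrite ?rmorphD // rpredD.
- exists (c%:MP * f); last by rewrite rmorphM.
  by rewrite mul_mpolyC rpredZ.
Qed.

Lemma coord_deg_const c : coord_deg 0 (@coord_const K n X c).
Proof.
apply: coord_degP; rewrite -[c%:MP]mulr1 mul_mpolyC rpredZ //; exact: dhomog1.
Qed.

Lemma coord_degX d e a : coord_deg d a -> coord_deg (d * e) (a ^+ e).
Proof.
move=> da; elim: e => [|e IH]; first by rewrite muln0; exact: coord_deg1.
by rewrite exprS mulnS; exact: coord_degM.
Qed.

Lemma coord_deg_x0X k : coord_deg k (x0 X ^+ k).
Proof.
rewrite -[X in coord_deg X]mul1n; apply: coord_degX.
exact: coord_degP (dhomog_var _ _).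
Qed.

Lemma coord_comp_pi d f : coord_comp d (cpi f) = cpi (pihomog mdeg d f).
Proof.
apply/coord_piP; rewrite -pihomogB; have [_ _ _] := vid_homog X; apply.
exact: coord_reprP.
Qed.

Lemma coord_comp_zmod_morphism d : zmod_morphism (@coord_comp K n X d).
Proof.
move=> a b; rewrite -(coord_piK a) -(coord_piK b) -rmorphB !coord_comp_pi.
by rewrite pihomogB rmorphB.
Qed.

HB.instance Definition _ d :=
  GRing.isZmodMorphism.Build R R (@coord_comp K n X d) (coord_comp_zmod_morphism d).

Lemma coord_comp_deg d a : coord_deg d (coord_comp d a).
Proof. exact: coord_degP (pihomogP mdeg d _). Qed.

Lemma coord_comp_id d e a : coord_deg d a ->
  coord_comp e a = if d == e then a else 0.
Proof.
move=> [f hf ->]; rewrite coord_comp_pi; case: eqVneq => [<-|ne].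
  by rewrite pihomog_dE.
by rewrite (pihomog_ne0 ne hf) rmorph0.
Qed.

Lemma coord_comp_ge d a : (msize (repr a) <= d)%N -> coord_comp d a = 0.
Proof. by move=> h; rewrite /coord_comp pihomog_ge // rmorph0. Qed.

Lemma coord_sum_comp k a : (msize (repr a) <= k)%N ->
  a = \sum_(i < k) coord_comp i a.
Proof.
by move=> h; rewrite -{1}(coord_piK a) {1}(pihomog_sum h) rmorph_sum.
Qed.

Lemma coord_comp_ext a b : (forall i, coord_comp i a = coord_comp i b) -> a = b.
Proof.
move=> e; set k := maxn (msize (repr a)) (msize (repr b)).
transitivity (\sum_(i < k) coord_comp i a); first exact: coord_sum_comp (leq_maxl _ _).
transitivity (\sum_(i < k) coord_comp i b); first by apply: eq_bigr => i _.
exact: esym (coord_sum_comp (leq_maxr _ _)).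
Qed.

Lemma coord_compM d e a b : coord_deg d a ->
  coord_comp e (a * b) = if (d <= e)%N then a * coord_comp (e - d) b else 0.
Proof.
move=> [f hf ->]; rewrite -(coord_piK b) -rmorphM !coord_comp_pi.
by rewrite (pihomogM_homog _ _ hf); case: ifP; rewrite ?rmorph0 ?rmorphM.
Qed.

Lemma coord_comp_sum k (F : nat -> R) i : (forall j, coord_deg j (F j)) ->
  coord_comp i (\sum_(j < k) F j) = if (i < k)%N then F i else 0.
Proof.
move=> FP; rewrite raddf_sum /=.
under eq_bigr do rewrite (coord_comp_id _ (FP _)).
case: ltnP => [lt|ge].
  rewrite (bigD1 (Ordinal lt)) //= eqxx big1 ?addr0 // => j ne.
  by case: eqP => // e; case/eqP: ne; apply: val_inj.
by apply: big1 => j _; case: eqP => // e; have := ltn_ord j; rewrite e ltnNge ge.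
Qed.

Lemma coord_geP d a : coord_ge d a <-> forall i, (i < d)%N -> coord_comp i a = 0.
Proof.
split=> [[f fd ->] i lid|a0].
  rewrite coord_comp_pi pihomogE big_seq_cond big1 ?rmorph0 // => m /andP[/fd dm /eqP mi].
  by move: dm; rewrite mi leqNgt lid.
exists (\sum_(i < msize (repr a) | (d <= i)%N) pihomog mdeg i (repr a)).
  move=> m; rewrite mcoeff_msupp raddf_sum /= => nz; rewrite leqNgt; apply/negP => lt.
  case/eqP: nz; apply: big1 => i di.
  apply: (dhomog_nemf_coeff (pihomogP mdeg i _)).
  by apply: contraTneq lt => ->; rewrite -leqNgt.
rewrite rmorph_sum [RHS]big_mkcond; apply: etrans (coord_sum_comp (leqnn _)) _.
by apply: eq_bigr => i _; case: leqP => // /a0.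
Qed.

Lemma coord_deg_finite d : finite_mod (@coord_const K n X) (@coord_deg K n X d) [set 0].
Proof.
pose M := 'X_{1..n.+1 < d.+1}.
exists #|{: M}|, (fun k => cpi 'X_[enum_val k : M]) => _ [f hf ->].
exists (fun k => f@_(enum_val k : M)); apply/eqP; rewrite subr_eq0; apply/eqP.
rewrite {1}(mpolywE (k := d.+1) (p := f)) ?rmorph_sum /=.
  rewrite (reindex_onto enum_val enum_rank) => [|i _]; last exact: enum_rankK.
  apply: eq_big => [k|k _]; first by rewrite enum_valK eqxx.
  by rewrite -mul_mpolyC rmorphM.
rewrite msizeE; apply/bigmax_leqP_seq => m mf _.
by rewrite (dhomog_mf hf).
Qed.

End CoordinateRing.

(** * Consequences of saturation and of the absence of points at X_0 = 0 *)

Section Regularity.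
Variables (K : fieldType) (n : nat) (X : pscheme K n).
Local Notation P := {mpoly K[n.+1]}.
Local Notation R := (coord X).
Local Notation cpi := (coord_pi X).

(* Dimension at most zero and no point on the hyperplane X_0 = 0; unlike      *)
(* [zero_dimensional], this is inherited by all closed subschemes, including  *)
(* the empty one.                                                             *)
Definition affine_finite : Prop :=
  (forall p q : ppoint K n, on_scheme X p -> on_scheme X q ->
     {subset pid p <= pid q} -> pid p =i pid q) /\ off_hyperplane X.

Hypothesis X_fin : affine_finite.

Lemma on_scheme_x0 p : on_scheme X p -> 'X_ord0 \notin pid p.
Proof.
move=> Xp; have [inc off] := X_fin.
have cl q : on_scheme X q -> {subset pid p <= pid q} -> {subset pid q <= pid p}.
  by move=> Xq pq f; rewrite (inc p q).
exact: (off (Supp Xp cl)).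
Qed.

Lemma on_scheme_supp p : on_scheme X p -> exists q : supp X, p = q.
Proof.
move=> Xp; have [inc _] := X_fin.
have cl q : on_scheme X q -> {subset pid p <= pid q} -> {subset pid q <= pid p}.
  by move=> Xq pq f; rewrite (inc p q).
by exists (Supp Xp cl).
Qed.

Lemma pid_exp (p : ppoint K n) f k : f ^+ k \in pid p -> f \in pid p.
Proof.
elim: k => [|k IH]; first by rewrite expr0 (negPf (pid1 p)).
by rewrite exprS => /pid_prime[].
Qed.

(** Pigeonhole: if all exponents were below N, the degree would be at most N (n + 1). *)
Lemma mnm_var_exp (m : 'X_{1..n.+1}) (N : nat) :
  (N * n.+1 < mdeg m)%N -> exists i, (U_(i) *+ N <= m)%MM.
Proof.
move=> lt; apply: contrapT => none; move: lt; apply/negP; rewrite -leqNgt mdegE.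
rewrite -[X in (_ <= _ * X)%N]card_ord mulnC -sum_nat_const; apply: leq_sum => i _.
rewrite leqNgt; apply/negP => lt; apply: none; exists i; apply/mnm_lepP => j.
by rewrite mulmnE mnm1E; case: eqVneq => [<-|_]; rewrite ?mul1n // ltnW.
Qed.

(** A projective Nullstellensatz. By [point_above] each variable has a power in J, and a monomial of
    large degree is divisible by one of these powers. *)
Lemma irrelevant_ideal (J : P -> bool) : homog_ideal J ->
  (forall p : ppoint K n, ~ {subset J <= pid p}) ->
  exists N, forall m : 'X_{1..n.+1}, (N <= mdeg m)%N -> J 'X_[m].
Proof.
move=> hJ none; have [J0 JD JM _] := hJ.
have /choice[k kP] i : exists k, J ('X_i ^+ k).
  apply: contrapT => nk; have [|p Jp _] := point_above (i := i) hJ.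
    by move=> k; apply/negP => Jk; apply: nk; exists k.
  exact: none Jp.
exists ((\max_i k i) * n.+1).+1 => m /mnm_var_exp[i le].
have {}le : (U_(i) *+ k i <= m)%MM.
  apply/mnm_lepP => j; have /mnm_lepP/(_ j) := le; apply: leq_trans.
  by rewrite !mulmnE leq_mul2l leq_bigmax orbT.
rewrite -(submK le) mpolyXD -mpolyXn; exact: JM (kP i).
Qed.

Lemma colon_homog d f : f \is d.-homog -> homog_ideal (fun g => `[< g * f \in vid X >]).
Proof.
have [I0 ID IM IH] := vid_homog X => hf.
split; first by apply/asboolP; rewrite mul0r.
- by move=> g h /asboolP gf /asboolP hf'; apply/asboolP; rewrite mulrDl; exact: ID.
- by move=> g h /asboolP hf'; apply/asboolP; rewrite -mulrA; exact: IM.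
- move=> g e /asboolP gf; apply/asboolP; rewrite mulrC.
  have := IH _ (d + e)%N gf; rewrite [g * f]mulrC (pihomogM_homog _ _ hf) leq_addr.
  by rewrite addKn.
Qed.

(** If x_0 kills the class of a form f, the ideal I_X : f contains I_X and X_0, hence lies in no
    point. It therefore contains all monomials of some degree, and f is in I_X by saturation. *)
Lemma x0_regular (a : R) : x0 X * a = 0 -> a = 0.
Proof.
have [I0 ID IM IH] := vid_homog X.
have hom d (b : R) : coord_deg d b -> x0 X * b = 0 -> b = 0.
  move=> [f hf ->] e0; apply/coord_pi_eq0.
  have X0f : 'X_ord0 * f \in vid X by apply/coord_pi_eq0; rewrite rmorphM.
  have hJ := colon_homog hf; set J := (fun _ => _) in hJ.
  have [|N JN] := irrelevant_ideal hJ.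
    move=> p Jp; have Xp : on_scheme X p.
      by move=> g Ig; apply: Jp; apply/asboolP; rewrite mulrC; exact: IM.
    by have /negP := on_scheme_x0 Xp; apply; apply: Jp; exact/asboolP.
  apply: (vid_sat (d := N)) => m mN.
  by have /asboolP := JN m (eq_leq (esym mN)).
move=> e0; apply: coord_comp_ext => i; rewrite raddf0.
apply: (hom i); first exact: coord_comp_deg.
have := congr1 (coord_comp i.+1) e0.
rewrite (coord_compM _ _ (coord_deg_x0X X 1)) expr1 raddf0.
by rewrite ltnS leq0n subn1.
Qed.

Lemma hnzd_x0X k : hnzd (x0 X ^+ k).
Proof.
elim: k => [|k IH]; first exact: hnzd1.
rewrite exprS; apply: hnzdM => //; split; last exact: x0_regular.
by exists 1%N; exact: (coord_deg_x0X X 1).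
Qed.

(** The ideal I_X + (X_0) lies in no point, hence contains all monomials of large degree. *)
Lemma coord_deg_generated : exists N, forall d (a : R), (N <= d)%N ->
  coord_deg d.+1 a -> exists2 b, coord_deg d b & a = x0 X * b.
Proof.
have [I0 ID IM IH] := vid_homog X.
pose J f := `[< exists g, f - 'X_ord0 * g \in vid X >].
have hJ : homog_ideal J.
  split; first by apply/asboolP; exists 0; rewrite mulr0 subrr.
  - move=> f g /asboolP[h fh] /asboolP[k gk]; apply/asboolP; exists (h + k).
    by rewrite mulrDr opprD addrACA; exact: ID.
  - move=> f g /asboolP[h gh]; apply/asboolP; exists (f * h).
    rewrite (_ : _ - _ = f * (g - 'X_ord0 * h)); first exact: IM.
    by ring.
  - move=> f d /asboolP[h fh]; apply/asboolP.
    exists (if (1 <= d)%N then pihomog mdeg (d - 1) h else 0).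
    have := IH _ d fh; rewrite pihomogB (pihomogM_homog _ _ (dhomog_var _ _)).
    by case: ifP; rewrite ?mulr0.
have [|N JN] := irrelevant_ideal hJ.
  move=> p Jp; have Xp : on_scheme X p.
    by move=> g Ig; apply: Jp; apply/asboolP; exists 0; rewrite mulr0 subr0.
  have /negP := on_scheme_x0 Xp; apply; apply: Jp; apply/asboolP; exists 1.
  by rewrite mulr1 subrr.
exists N => d _ leNd [f hf ->].
have /asboolP[g] : J f.
  have [J0 JD JM _] := hJ.
  rewrite [f]mpolyE big_seq; elim/big_ind: _ => // m mf.
  rewrite -mul_mpolyC; apply: JM; apply: JN.
  by rewrite (dhomog_mf hf mf) leqW.
move=> /(IH _ d.+1); rewrite pihomogB pihomog_dE // (pihomogM_homog _ _ (dhomog_var _ _)).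
rewrite ltnS leq0n subn1 /= => /coord_piP ->; exists (cpi (pihomog mdeg d g)).
  exact: coord_degP (pihomogP mdeg d g).
exact: rmorphM.
Qed.

End Regularity.

(** * The affine coordinate ring and its filtration *)

Section AffineRing.
Variables (K : fieldType) (n : nat) (X : pscheme K n).
Local Notation R := (coord X).

HB.instance Definition _ := GRing.RMorphism.copy (toQh X) (to_loc (hnzd_mulset X)).

Lemma toQh_inj : injective (toQh X).
Proof.
move=> a b e; apply/eqP; rewrite -subr_eq0; apply/eqP.
have /to_loc_eq0[u [_ reg] u0] : to_loc (hnzd_mulset X) (a - b) = 0.
  by apply/eqP; rewrite rmorphB subr_eq0; apply/eqP.
exact: reg u0.
Qed.

(* The ring of fractions a / x_0^k with a in R_k: the degree 0 part of R_x0,  *)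
(* realised inside Q^h(R).                                                    *)
Definition aff_pred : {pred Qh X} :=
  fun q => `[< exists k, exists2 a : R, coord_deg k a & q * toQh X (x0 X) ^+ k = toQh X a >].

Lemma aff_subring : subring_closed aff_pred.
Proof.
split=> [|x y|x y].
- by apply/asboolP; exists 0%N, 1; [exact: coord_deg1|rewrite mul1r rmorph1].
- move=> /asboolP[k [a ka xa]] /asboolP[l [b lb yb]]; apply/asboolP.
  exists (k + l)%N, (a * x0 X ^+ l - b * x0 X ^+ k).
    apply: (subspaceB (coord_deg_subspace X (k + l))).
      by apply: coord_degM ka _; exact: coord_deg_x0X.
    by rewrite addnC; apply: coord_degM lb _; exact: coord_deg_x0X.
  by rewrite rmorphB !rmorphM !rmorphXn /= -xa -yb exprD; ring.
- move=> /asboolP[k [a ka xa]] /asboolP[l [b lb yb]]; apply/asboolP.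
  exists (k + l)%N, (a * b); first exact: coord_degM.
  by rewrite rmorphM /= -xa -yb exprD; ring.
Qed.

HB.instance Definition _ :=
  GRing.isSubringClosed.Build (Qh X) aff_pred aff_subring.

Record aff := Aff { aff_val : Qh X; affP : aff_val \in aff_pred }.

HB.instance Definition _ := [isSub for aff_val].
HB.instance Definition _ := [Choice of aff by <:].
HB.instance Definition _ :=
  GRing.SubChoice_isSubComPzRing.Build _ _ aff aff_subring.

Implicit Types (s t : aff) (a b : R).

(** The relation s = a / x_0^i. It is the correspondence through which dimensions and products pass
    between R_i and [filt i]. *)
Definition frac_of i a s : Prop := coord_deg i a /\ val s * toQh X (x0 X) ^+ i = toQh X a.

Definition filt i : set aff := [set s | exists a, frac_of i a s].

(** For a in R_i this is a / x_0^i, and the default value 0 does not interfere ([dehomP]). *)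
Definition dehom i a : aff := insubd 0 (loc_frac (hnzd_mulset X) a (x0 X ^+ i)).

Definition aff_const (c : K) : aff := dehom 0 (coord_const X c).

Lemma val_aff_const c : val (aff_const c) = toQh X (coord_const X c).
Proof.
rewrite /aff_const /dehom expr0 val_insubd (_ : loc_frac _ _ _ = toQh X (coord_const X c)) //.
case: ifP => // /negP[]; apply/asboolP; exists 0%N, (coord_const X c); last exact: mulr1.
exact: coord_deg_const.
Qed.

Lemma aff_const_zmod_morphism : zmod_morphism aff_const.
Proof. by move=> a b; apply: val_inj; rewrite rmorphB /= !val_aff_const !rmorphB. Qed.

Lemma aff_const_monoid_morphism : monoid_morphism aff_const.
Proof.
split=> [|a b]; apply: val_inj; first by rewrite val_aff_const !rmorph1.
by rewrite rmorphM /= !val_aff_const !rmorphM.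
Qed.

HB.instance Definition _ :=
  GRing.isZmodMorphism.Build K aff aff_const aff_const_zmod_morphism.
HB.instance Definition _ :=
  GRing.isMonoidMorphism.Build K aff aff_const aff_const_monoid_morphism.

Lemma frac_of_exists s : exists i a, frac_of i a s.
Proof. by have /asboolP[i [a ? ?]] := affP s; exists i, a. Qed.

Lemma frac_of0 i : frac_of i 0 0.
Proof. by split; [case: (coord_deg_subspace X i)|rewrite !rmorph0 mul0r]. Qed.

Lemma frac_ofD i a b s t : frac_of i a s -> frac_of i b t -> frac_of i (a + b) (s + t).
Proof.
move=> [ia sa] [ib tb]; split; first by case: (coord_deg_subspace X i) => _ + _; apply.
by rewrite !rmorphD /= mulrDl sa tb.
Qed.

Lemma frac_ofM i j a b s t : frac_of i a s -> frac_of j b t -> frac_of (i + j) (a * b) (s * t).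
Proof.
move=> [ia sa] [ib tb]; split; first exact: coord_degM.
by rewrite !rmorphM /= exprD mulrACA sa tb.
Qed.

Lemma frac_of_const c : frac_of 0 (coord_const X c) (aff_const c).
Proof. by split; [exact: coord_deg_const|rewrite val_aff_const mulr1]. Qed.

Lemma frac_ofZ i c a s : frac_of i a s -> frac_of i (coord_const X c * a) (aff_const c * s).
Proof. exact: frac_ofM (frac_of_const c). Qed.

Lemma frac_ofN i a s : frac_of i a s -> frac_of i (- a) (- s).
Proof. by move=> /(frac_ofZ (-1)); rewrite !rmorphN1 !mulN1r. Qed.

Lemma frac_ofB i a b s t : frac_of i a s -> frac_of i b t -> frac_of i (a - b) (s - t).
Proof. by move=> sa /frac_ofN; exact: frac_ofD. Qed.

Lemma frac_of_x0X k : frac_of k (x0 X ^+ k) 1.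
Proof. by split; [exact: coord_deg_x0X|rewrite rmorph1 mul1r rmorphXn]. Qed.

Lemma frac_of_inj i a b s : frac_of i a s -> frac_of i b s -> a = b.
Proof. by move=> [_ sa] [_ sb]; apply: toQh_inj; rewrite -sa -sb. Qed.

Lemma frac_of_shift i k a s : frac_of i a s -> frac_of (i + k) (a * x0 X ^+ k) s.
Proof. by move=> sa; rewrite -[s]mulr1; apply: frac_ofM sa (frac_of_x0X k). Qed.

Lemma filt_subspace i : subspace aff_const (filt i).
Proof.
split=> [|s t [a sa] [b tb]|c s [a sa]]; first by exists 0; exact: frac_of0.
  by exists (a + b); exact: frac_ofD.
by exists (coord_const X c * a); exact: frac_ofZ.
Qed.

Lemma filtS i j : (i <= j)%N -> filt i `<=` filt j.
Proof.
by move=> le s [a sa]; exists (a * x0 X ^+ (j - i)); rewrite -(subnKC le) addKn; exact: frac_of_shift.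
Qed.

Hypothesis X_fin : affine_finite X.

Lemma toQh_x0X_cancel k (x y : Qh X) :
  x * toQh X (x0 X) ^+ k = y * toQh X (x0 X) ^+ k -> x = y.
Proof. by rewrite -rmorphXn; apply: to_loc_cancel; exact: hnzd_x0X. Qed.

Lemma frac_of_uniq i a s t : frac_of i a s -> frac_of i a t -> s = t.
Proof.
by move=> [_ sa] [_ ta]; apply: val_inj; apply: (toQh_x0X_cancel (k := i)); rewrite sa ta.
Qed.

Lemma frac_of_eq0 i a : frac_of i a 0 -> a = 0.
Proof. by move=> /frac_of_inj; apply; exact: frac_of0. Qed.

Lemma dehomP i a : coord_deg i a -> frac_of i a (dehom i a).
Proof.
move=> ia; split=> //.
have e : loc_frac (hnzd_mulset X) a (x0 X ^+ i) * toQh X (x0 X) ^+ i = toQh X a.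
  by rewrite -(rmorphXn (toQh X)); apply: loc_fracK; exact: hnzd_x0X.
rewrite /dehom val_insubd; case: ifP => // /negP[]; apply/asboolP.
by exists i, a.
Qed.

Lemma dehom_eq0 i a : coord_deg i a -> dehom i a = 0 -> a = 0.
Proof. by move=> /dehomP + e; rewrite e => /frac_of_eq0. Qed.

Lemma dehomE i a s : frac_of i a s -> dehom i a = s.
Proof. by move=> sa; apply: (@frac_of_uniq i a) => //; apply: dehomP; case: sa. Qed.

Lemma filt_full : exists N, filt N = setT.
Proof.
have [N gen] := coord_deg_generated X_fin; exists N.
(* Since R_{d+1} = x_0 R_d, a factor x_0 cancels in each fraction. *)
have down d : (N <= d)%N -> filt d.+1 `<=` filt d.
  move=> Nd s [a [da sa]]; have [b db ab] := gen d a Nd da; exists b; split=> //.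
  apply: (toQh_x0X_cancel (k := 1)); rewrite -mulrA -exprD addn1 sa ab rmorphM.
  by rewrite mulrC expr1.
apply/seteqP; split=> // s _; have [i [a sa]] := frac_of_exists s.
have : filt (N + i) s by apply: (filtS (leq_addl N i)); exists a.
elim: i {a sa} => [|i IH]; first by rewrite addn0.
by rewrite addnS => /(down _ (leq_addr _ _)).
Qed.

Lemma filt_dim i :
  dim_mod (@coord_const K n X) (@coord_deg K n X i) [set 0] = dim_mod aff_const (filt i) [set 0].
Proof.
apply: (@transfer_dim _ _ _ (@coord_const K n X) aff_const (frac_of i)).
- exact: frac_of0.
- by move=> *; exact: frac_ofD.
- by move=> *; exact: frac_ofZ.
- exact: coord_deg_subspace.
- exact: subspace0.
- exact: filt_subspace.
- exact: subspace0.
- by move=> a /dehomP ia; exists (dehom i a) => //; exists a.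
- by move=> s [a sa]; exists a => //; case: sa.
- move=> a s sa; split=> /= e; last by move: sa; rewrite e => /frac_of_eq0.
  by apply: (@frac_of_uniq i 0); rewrite -?e //; rewrite e; exact: frac_of0.
Qed.

Lemma aff_finite : finite_mod aff_const setT [set 0].
Proof.
have [N <-] := filt_full.
apply: (@transfer_finite _ _ _ (@coord_const K n X) aff_const (frac_of N) _ _ _ (@coord_deg K n X N) [set 0]).
- exact: frac_of0.
- by move=> *; exact: frac_ofD.
- by move=> *; exact: frac_ofZ.
- exact: coord_deg_subspace.
- exact: subspace0.
- exact: filt_subspace.
- exact: subspace0.
- by move=> a /dehomP ia; exists (dehom N a) => //; exists a.
- by move=> s [a sa]; exists a => //; case: sa.
- move=> a s sa; split=> /= e; last by move: sa; rewrite e => /frac_of_eq0.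
  by apply: (@frac_of_uniq N 0); rewrite -?e //; rewrite e; exact: frac_of0.
- exact: coord_deg_finite.
Qed.

End AffineRing.

(** The powers of u are linearly dependent. Dividing a relation by its nonzero coefficient of lowest
    index k gives u^k (1 - u w) = 0, so multiplication by u w fixes every multiple of u^k, and e =
    (u w)^{k+1} is idempotent. If u is a unit then e = 1, and if u is nilpotent then e = 0. *)
Lemma fitting_idempotent (K : fieldType) (B : comPzRingType) (c : {rmorphism K -> B}) (u : B) :
  finite_mod c setT [set 0] ->
  exists e v k, [/\ e * e = e, e = u * v & u ^+ k * (1 - e) = 0].
Proof.
move=> /(finite_mod_sub (@subset_refl _ setT) (@subset_refl _ [set 0]) (subspace0 c))[D bound].
have [a a0 [j aj]] : exists2 a : 'I_D.+1 -> K, lincomb c a (fun k => u ^+ k) = 0 & exists j, a j != 0.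
  apply: contrapT => na; suff /bound : free_mod c [set 0] (fun k : 'I_D.+1 => u ^+ k).
    by rewrite ltnn => /(_ (fun=> I)).
  move=> a a0 k; apply: contrapT => ak; apply: na; exists a => //.
  by exists k; apply/eqP.
have [k [w e]] : exists k w, u ^+ k * (1 - u * w) = 0.
  pose Q k := [exists j : 'I_D.+1, (j == k :> nat) && (a j != 0)].
  have Q0 : exists k, Q k by exists j; apply/existsP; exists j; rewrite eqxx.
  case: (ex_minnP Q0) => k /existsP[i /andP[/eqP ik ai]] mink.
  exists k, (- c (a i)^-1 * \sum_(l < D.+1 | (k < l)%N) c (a l) * u ^+ (l - k.+1)).
  rewrite mulrBr mulr1 mulNr !mulrN opprK [u ^+ k * _]mulrA -exprSr mulrCA.
  have := congr1 ( *%R (c (a i)^-1)) a0.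
  rewrite mulr0 /lincomb (bigID (fun l : 'I__ => (k < l)%N)) /= mulrDr addrC.
  rewrite (bigD1 i) ?ik ?ltnn //= big1 ?addr0 => [|l /andP[lk li]].
    rewrite mulrA -rmorphM mulVf // rmorph1 mul1r => e0; apply: etrans e0.
    congr (_ + _ * _); rewrite mulr_sumr; apply: eq_bigr => l kl.
    by rewrite mulrCA -exprD subnKC.
  have [->|al] := eqVneq (a l) 0; first by rewrite rmorph0 mul0r.
  have : (k <= l)%N by apply: mink; apply/existsP; exists l; rewrite eqxx.
  move: lk; rewrite -leqNgt => lk kl; case/eqP: li; apply: val_inj => /=.
  by rewrite ik; apply/eqP; rewrite eqn_leq lk kl.
have absorb x m : x * (1 - u * w) = 0 -> x * (u * w) ^+ m = x.
  move=> x0; elim: m => [|m IH]; first by rewrite mulr1.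
  rewrite exprSr (mulrA x) IH; apply/eqP; rewrite -subr_eq0 -oppr_eq0 opprB.
  by rewrite -[X in X - _]mulr1 -mulrBr x0.
exists ((u * w) ^+ k.+1), (w * (u * w) ^+ k), k; split.
- apply: absorb; transitivity (u * w * w ^+ k * (u ^+ k * (1 - u * w))).
    by rewrite exprS exprMn; ring.
  by rewrite e mulr0.
- by rewrite exprS mulrA.
- by rewrite mulrBr mulr1 absorb ?subrr.
Qed.

(** * Local rings at the points of the support *)

Section Stalks.
Variables (K : fieldType) (n : nat) (X : pscheme K n).
Local Notation P := {mpoly K[n.+1]}.
Local Notation cpi := (coord_pi X).
Implicit Types (f g : P) (a b : coord X) (s t u : aff X).

Lemma frac_of_poly s : exists i f, f \is i.-homog /\ frac_of i (cpi f) s.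
Proof.
have [i [_ [[f hf ->] sf]]] := frac_of_exists s; exists i, f; split=> //; split=> //.
exact: coord_degP.
Qed.

Section OnePoint.
Variable p : ppoint K n.
Local Notation L := (loc (off_mulset X p)).
Local Notation iota := (to_loc (off_mulset X p)).

Lemma stalk_fracP d a b : coord_deg d a -> coord_deg d b -> off_point p b ->
  val (stalk_frac p a b) * iota b = iota a.
Proof.
move=> da db pb; rewrite /stalk_frac val_insubd; case: ifP => [_|/negP[]].
  exact: (loc_fracK (S := off_mulset X p)).
by apply/asboolP; exists d, d, a, b; rewrite subrr.
Qed.

Lemma stalk_rep (x : stalk X p) : exists d a b,
  [/\ coord_deg d a, coord_deg d b, off_point p b & val x * iota b = iota a].
Proof.
have /asboolP[d [e [a [b [da eb pb /esym/eqP]]]]] := stalk_valP x.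
rewrite subr_eq0 => /eqP[de] xE; exists d, a, b; rewrite {2}de; split=> //.
by apply/(loc_fracP (S := off_mulset X p)).
Qed.

Lemma stalk_cancel b (x y : stalk X p) :
  off_point p b -> val x * iota b = val y * iota b -> x = y.
Proof. by move=> pb e; apply: val_inj; apply: (to_loc_cancel (S := off_mulset X p) pb). Qed.

Lemma val_stalk_const c : val (stalk_const X p c) = iota (coord_const X c).
Proof.
have := stalk_fracP (coord_deg_const X c) (coord_deg1 X) (off_point1 X p).
by rewrite rmorph1 mulr1.
Qed.

Lemma stalk_const_zmod_morphism : zmod_morphism (stalk_const X p).
Proof. by move=> a b; apply: val_inj; rewrite rmorphB /= !val_stalk_const !rmorphB. Qed.

Lemma stalk_const_monoid_morphism : monoid_morphism (stalk_const X p).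
Proof.
split=> [|a b]; apply: val_inj; first by rewrite val_stalk_const !rmorph1.
by rewrite rmorphM /= !val_stalk_const !rmorphM.
Qed.

HB.instance Definition _ :=
  GRing.isZmodMorphism.Build K (stalk X p) (stalk_const X p) stalk_const_zmod_morphism.
HB.instance Definition _ :=
  GRing.isMonoidMorphism.Build K (stalk X p) (stalk_const X p) stalk_const_monoid_morphism.

End OnePoint.

Hypothesis X_fin : affine_finite X.

Lemma off_point_x0X (p : supp X) k : off_point p (x0 X ^+ k).
Proof.
elim: k => [|k IH]; first exact: off_point1.
rewrite exprS; apply: off_pointM IH; exists 1%N, 'X_ord0; split=> //.
  exact: dhomog_var.
by case: X_fin => _ /(_ p).
Qed.

(** An element of S is a fraction in many degrees. One of them is chosen here, and [germ_funP] shows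
    that the choice does not matter. *)
Definition germ_fun (p : supp X) s : stalk X p :=
  stalk_frac p (sval (cid (svalP (cid (frac_of_exists s)))))
    (x0 X ^+ sval (cid (frac_of_exists s))).

Lemma germ_funP (p : supp X) i a s : frac_of i a s ->
  val (germ_fun p s) * to_loc _ (x0 X ^+ i) = to_loc (off_mulset X p) a.
Proof.
rewrite /germ_fun; case: cid => j /= h; case: cid => b /= sb sa.
apply: (to_loc_cancel (S := off_mulset X p) (off_point_x0X p j)).
rewrite mulrAC (stalk_fracP _ (coord_deg_x0X X j) (off_point_x0X p j)).
  rewrite -!rmorphM; congr to_loc; apply: (frac_of_inj (i := j + i) (s := s)).
    exact: frac_of_shift.
  by rewrite addnC; exact: frac_of_shift.
by case: sb.
Qed.

Lemma germ_funE (p : supp X) i a s (x : stalk X p) : frac_of i a s ->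
  val x * to_loc _ (x0 X ^+ i) = to_loc (off_mulset X p) a -> germ_fun p s = x.
Proof.
by move=> sa xa; apply: (stalk_cancel (off_point_x0X p i)); rewrite xa; exact: germ_funP.
Qed.

Lemma germ_fun_zmod_morphism p : zmod_morphism (germ_fun p).
Proof.
move=> s t; have [i [a sa]] := frac_of_exists s; have [j [b tb]] := frac_of_exists t.
have sa' := frac_of_shift j sa; have := frac_of_shift i tb; rewrite addnC => tb'.
apply: (germ_funE (frac_ofB sa' tb')).
by rewrite !rmorphB /= mulrBl (germ_funP p sa') (germ_funP p tb').
Qed.

Lemma germ_fun_monoid_morphism p : monoid_morphism (germ_fun p).
Proof.
split=> [|s t].
  by apply: (germ_funE (frac_of_x0X X 0)); rewrite !rmorph1 mul1r.
have [i [a sa]] := frac_of_exists s; have [j [b tb]] := frac_of_exists t.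
apply: (germ_funE (frac_ofM sa tb)).
by rewrite exprD !rmorphM /= mulrACA (germ_funP p sa) (germ_funP p tb).
Qed.

(** The morphism structure of [germ_fun] rests on the hypothesis [X_fin]; it is packed in an
    existential from which [rho] is chosen. *)
Lemma germ_morphism (p : supp X) :
  exists r : {rmorphism aff X -> stalk X p}, r =1 germ_fun p.
Proof.
pose r : {rmorphism aff X -> stalk X p} := HB.pack (germ_fun p)
  (GRing.isZmodMorphism.Build _ _ (germ_fun p) (@germ_fun_zmod_morphism p))
  (GRing.isMonoidMorphism.Build _ _ (germ_fun p) (germ_fun_monoid_morphism p)).
by exists r.
Qed.

Definition rho (p : supp X) : {rmorphism aff X -> stalk X p} := sval (cid (germ_morphism p)).

Lemma rhoE p s : rho p s = germ_fun p s.
Proof. exact: (svalP (cid (germ_morphism p))). Qed.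

Lemma rhoP (p : supp X) i a s : frac_of i a s ->
  val (rho p s) * to_loc _ (x0 X ^+ i) = to_loc (off_mulset X p) a.
Proof. by rewrite rhoE; exact: germ_funP. Qed.

Lemma rho_germ (p : supp X) i a s : frac_of i a s -> rho p s = germ p i a.
Proof.
move=> sa; rewrite rhoE; apply: (germ_funE sa); apply: (@stalk_fracP p i); first by case: sa.
  exact: coord_deg_x0X.
exact: off_point_x0X.
Qed.

Lemma rho_const (p : supp X) c : rho p (aff_const X c) = stalk_const X p c.
Proof.
by rewrite rhoE; apply: (germ_funE (frac_of_const X c)); rewrite expr0 rmorph1 mulr1 val_stalk_const.
Qed.

Definition off (p : supp X) s : Prop :=
  exists i f, [/\ f \is i.-homog, f \notin pid p & frac_of i (cpi f) s].

Lemma off1 p : off p 1.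
Proof. by exists 0%N, 1; split; [exact: dhomog1|exact: pid1|exact: (frac_of_x0X X 0)]. Qed.

Lemma offM p s t : off p s -> off p t -> off p (s * t).
Proof.
move=> [i [f [hf pf sf]]] [j [g [hg pg tg]]]; exists (i + j)%N, (f * g); split.
- exact: dhomogM.
- by apply/negP => /pid_prime[]; apply/negP.
- by rewrite rmorphM; exact: frac_ofM.
Qed.

(** The inverse of f / x_0^i is x_0^i / f. *)
Lemma rho_off p s : off p s -> exists x, rho p s * x = 1.
Proof.
move=> [i [f [hf pf sf]]]; have pi : off_point p (cpi f) by exists i, f.
have h1 := rhoP p sf.
have h2 := stalk_fracP (coord_deg_x0X X i) (coord_degP X hf) pi.
set x := stalk_frac _ _ _ in h2; exists x.
apply: (stalk_cancel (off_pointM pi (off_point_x0X p i))).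
have -> : val (rho p s * x) = val (rho p s) * val x by [].
have -> : val (1 : stalk X p) = 1 by [].
rewrite (rmorphM (to_loc _)) /= mul1r -{2}h1 -{3}h2 [RHS]mulrACA; congr (_ * _); exact: mulrC.
Qed.

Lemma rho_eq0 p s : rho p s = 0 <-> exists2 u, off p u & u * s = 0.
Proof.
split=> [s0|[u /rho_off[x ux] us]]; last first.
  by rewrite -[LHS]mul1r -ux mulrAC -rmorphM us rmorph0 mul0r.
have [i [a sa]] := frac_of_exists s.
have /esym := rhoP p sa; rewrite s0 (_ : val 0 = 0) // mul0r.
move=> /to_loc_eq0[_ [j [g [hg pg ->]]] ga].
have ug := dehomP X_fin (coord_degP X hg).
exists (dehom j (cpi g)); first by exists j, g.
apply: (frac_of_uniq X_fin (frac_ofM ug sa)); rewrite ga; exact: frac_of0.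
Qed.

(** At p the factor u^k in u^k (1 - e) = 0 is invertible, so 1 - e has germ 0. *)
Lemma rho_unit_idem p u : (exists y, rho p u * y = 1) ->
  exists e v, [/\ e * e = e, e = u * v & rho p e = 1].
Proof.
have [e [v [k [ee ev ue]]]] := fitting_idempotent u (aff_finite X_fin).
move=> [y uy]; exists e, v; split=> //; apply/eqP; rewrite eq_sym -subr_eq0; apply/eqP.
have := congr1 (rho p) ue; rewrite rmorph0 rmorphM rmorphXn rmorphB rmorph1.
by move=> /(congr1 ( *%R (y ^+ k))); rewrite mulrA -exprMn [y * _]mulrC uy expr1n mul1r mulr0.
Qed.

(** Write x = s / u with u off p. The idempotent e = u v has germ 1, so v has the germ 1 / u and x
    is the germ of v s. *)
Lemma rho_surj (p : supp X) (x : stalk X p) : exists s, rho p s = x.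
Proof.
have [d [a [b [da db [e [t [et pt bt]]] xE]]]] := stalk_rep x.
rewrite {}bt in db xE.
have up := dehomP X_fin db; have sp := dehomP X_fin da.
set u := dehom _ _ in up; set s := dehom _ _ in sp.
have offu : off p u.
  move: db => [f hf tf]; exists d, f; rewrite -tf; split=> //.
  apply: contra pt => pf; have [_ PD _ _] := pid_homog p.
  by have /coord_piP/(@supp_on _ _ X p) := tf => /PD/(_ pf); rewrite subrK.
have [ee [v [_ uv re]]] := rho_unit_idem (rho_off offu).
exists (v * s); rewrite rmorphM.
have -> : rho p s = rho p u * x.
  apply: (stalk_cancel (off_point_x0X p d)).
  rewrite (rhoP p sp) -xE (_ : val (rho p u * x) = val (rho p u) * val x) //.
  by rewrite mulrAC (rhoP p up) mulrC.
by rewrite mulrA [rho p v * _]mulrC -rmorphM -uv re mul1r.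
Qed.

Lemma rho_kernel_subspace p : subspace (aff_const X) [set s | rho p s = 0].
Proof.
split=> /= [|s t s0 t0|c s s0]; first by rewrite rmorph0.
  by rewrite rmorphD s0 t0 addr0.
by rewrite rmorphM s0 mulr0.
Qed.

Lemma off_prod p (m : nat) (F : 'I_m -> aff X) : (forall k, off p (F k)) -> off p (\prod_k F k).
Proof. by move=> FP; elim/big_ind: _ => //; [exact: off1|exact: offM]. Qed.

(** The kernel of [rho p] has a finite basis, and each basis element is killed by an element off p.
    The product of these elements is off p, and its idempotent kills the whole kernel. *)
Lemma stalk_idempotent p : exists e, [/\ e * e = e, rho p e = 1
  & forall s, rho p s = 0 -> e * s = 0].
Proof.
have [m [k kb]] := basis_exists (@subsetT _ [set s | rho p s = 0]) (@subset_refl _ [set 0])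
  (rho_kernel_subspace p) (subspace0 _) (aff_finite X_fin).
have [k0 span _] := iffLR (basis_modP k (rho_kernel_subspace p) (subspace0 _)) kb.
have /choice[u uP] j : exists u, off p u /\ u * k j = 0.
  by have /rho_eq0[u ? ?] := k0 j; exists u.
have offu : off p (\prod_j u j) by apply: off_prod => j; case: (uP j).
have [e [v [ee ev re]]] := rho_unit_idem (rho_off offu); exists e; split=> // s.
move=> /span[a /eqP]; rewrite subr_eq0 => /eqP ->.
rewrite mulr_sumr big1 // => j _; rewrite ev (bigD1 j) //=.
rewrite -(mulrA (u j)) [_ * k j]mulrC mulrACA.
by rewrite (proj2 (uP j)) mul0r.
Qed.

(** The numerator X_0^i - f is not in p because X_0 is not. *)
Lemma off_1B (p : supp X) i f s : f \is i.-homog -> f \in pid p -> frac_of i (cpi f) s -> off p (1 - s).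
Proof.
move=> hf pf sf; exists i, ('X_ord0 ^+ i - f); split.
- by rewrite rpredB // -[i in _ \is i.-homog]mul1n; apply: dhomogMn; exact: dhomog_var.
- have [_ PD _ _] := pid_homog p; apply/negP => /PD/(_ pf); rewrite subrK => /pid_exp.
  by apply/negP; case: X_fin => _; exact.
- by rewrite rmorphB rmorphXn; apply: frac_ofB sf; exact: frac_of_x0X.
Qed.

Lemma supp_eq (p q : supp X) : pid p =i pid q -> p = q.
Proof.
case: p q => [[I hI pI rI] p1 p2] [[J hJ pJ rJ] q1 q2] /= IJ.
have {}IJ : I = J by apply/funext => f; exact: IJ.
subst J; rewrite (Prop_irrelevance hI hJ) (Prop_irrelevance pI pJ) in p1 p2 *.
by rewrite (Prop_irrelevance rI rJ) in p1 p2 *; congr Supp; exact: Prop_irrelevance.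
Qed.

(** In dimension 0 some form lies in p but not in q. The idempotent e of its fraction has germ 1 at
    q and a numerator in p, so 1 - e is off p and kills e. *)
Lemma stalk_separation (p q : supp X) : p <> q -> exists e, rho p e = 0 /\ rho q e = 1.
Proof.
move=> pq; have [f [pf qf]] : exists f, f \in pid p /\ f \notin pid q.
  apply: contrapT => none; apply: pq; apply: supp_eq.
  have [inc _] := X_fin; apply: inc; [exact: supp_on|exact: supp_on|].
  by move=> f pf; apply: contrapT => /negP qf; apply: none; exists f.
have [i qi] : exists i, pihomog mdeg i f \notin pid q.
  apply: contrapT => none; case/negP: qf; apply: (homog_idealP (pid_homog q)) => i.
  by apply: contrapT => /negP qi; apply: none; exists i.
have {}pi : pihomog mdeg i f \in pid p by have [_ _ _] := pid_homog p; apply.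
have hg := pihomogP mdeg i f; set g := pihomog mdeg i f in qi pi hg.
have ug := dehomP X_fin (coord_degP X hg).
have [|e [v [ee ev re]]] := @rho_unit_idem q (dehom i (cpi g)).
  by apply: rho_off; exists i, g.
exists e; split=> //; apply/rho_eq0; exists (1 - e); last by rewrite mulrBl mul1r ee subrr.
have [j [h [hh vh]]] := frac_of_poly v.
apply: (off_1B (i := (i + j)%N) (f := h * g)).
- by rewrite mulrC; exact: dhomogM.
- by have [_ _ PM _] := pid_homog p; exact: PM.
- have := frac_ofM ug vh; by rewrite -ev -rmorphM [h * g]mulrC.
Qed.

(** If all germs of s = f / x_0^i vanish, the annihilator of the class of f is contained in no
    point. So it contains a power of X_0, and f vanishes in R by regularity of x_0. *)
Lemma rho_inj s t : (forall p, rho p s = rho p t) -> s = t.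
Proof.
move=> e; apply/eqP; rewrite -subr_eq0; apply/eqP.
have {e} s0 p : rho p (s - t) = 0 by rewrite rmorphB e subrr.
move: {s t} (s - t) s0 => s s0.
have [i [f [hf sf]]] := frac_of_poly s.
have [I0 ID IM IH] := vid_homog X.
have hJ := colon_homog X hf; set J := (fun _ => _) in hJ.
have [|N JN] := irrelevant_ideal hJ.
  move=> p' Jp'; have Xp' : on_scheme X p'.
    by move=> g Ig; apply: Jp'; apply/asboolP; rewrite mulrC; exact: IM.
  have [p pE] := on_scheme_supp X_fin Xp'; rewrite {}pE in Jp'.
  have /rho_eq0[u [j [g [hg /negP pg ug]]] us] := s0 p; apply: pg; apply: Jp'.
  apply/asboolP; apply/coord_pi_eq0; rewrite rmorphM.
  by have := frac_ofM ug sf; rewrite us => /(frac_of_eq0).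
have /JN/asboolP XN : (N <= mdeg (U_(ord0) *+ N : 'X_{1..n.+1}))%N by rewrite mdegMn mdeg1 mul1n.
have {XN} f0 := (coord_pi_eq0 X _).2 XN; rewrite -mpolyXn rmorphM rmorphXn in f0.
have f00 : cpi f = 0 by case: (hnzd_x0X X_fin N) => _; apply.
by apply: (frac_of_uniq X_fin sf); rewrite f00; exact: frac_of0.
Qed.

End Stalks.

(** * Decomposition into local rings *)

Section Decomposition.
Variables (K : fieldType) (n : nat) (X : pscheme K n).
Hypothesis X_fin : affine_finite X.
Local Notation rho := (rho X_fin).
Implicit Types (p q : supp X) (s t : aff X).

Definition idem p : aff X := sval (cid (stalk_idempotent X_fin p)).

Lemma rho_idem p : rho p (idem p) = 1.
Proof. by case: (svalP (cid (stalk_idempotent X_fin p))). Qed.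

Lemma idem_kernel p s : rho p s = 0 -> idem p * s = 0.
Proof. by case: (svalP (cid (stalk_idempotent X_fin p))) => _ _; apply. Qed.

Lemma rho_idem_neq p q : p <> q -> rho q (idem p) = 0.
Proof.
move=> pq; have [e [pe qe]] := stalk_separation X_fin pq.
by have := congr1 (rho q) (idem_kernel pe); rewrite rmorphM qe mulr1 rmorph0.
Qed.

Lemma rho_sum_idem (r : seq (supp X)) (x : supp X -> aff X) q : uniq r ->
  rho q (\sum_(p <- r) idem p * x p) = if q \in r then rho q (x q) else 0.
Proof.
move=> ur; rewrite rmorph_sum.
have term p : p != q -> rho q (idem p * x p) = 0.
  by move=> /eqP pq; rewrite rmorphM (rho_idem_neq pq) mul0r.
case: ifPn => [qr|nqr].
  rewrite (bigD1_seq q) //= big1 => [|p pq]; last exact: term.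
  by rewrite addr0 rmorphM rho_idem mul1r.
rewrite big_seq big1 // => p pr; apply: term.
by apply: contraNneq nqr => <-.
Qed.

(** The idempotents of distinct points are linearly independent in S. *)
Lemma supp_finite : exists2 r : seq (supp X), uniq r & forall p, p \in r.
Proof.
have [D bound] := finite_mod_sub (@subset_refl _ setT) (@subset_refl _ [set 0])
  (subspace0 _) (aff_finite X_fin).
have ubound (r : seq (supp X)) : uniq r -> (size r <= D)%N.
  move=> ur; pose f (k : 'I_(size r)) := idem (tnth (in_tuple r) k).
  apply: (bound _ f) => // a a0 k; apply: contrapT => ak.
  have := congr1 (rho (tnth (in_tuple r) k)) a0; rewrite rmorph0 /lincomb rmorph_sum.
  rewrite (bigD1 k) //= big1 ?addr0 => [|j jk]; last first.
    rewrite rmorphM /f rho_idem_neq ?mulr0 // => e; case/eqP: jk; apply: val_inj => /=.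
    apply/eqP; rewrite -(nth_uniq (tnth_default (in_tuple r) j) (ltn_ord j) (ltn_ord k) ur).
    by move: e; rewrite !(tnth_nth (tnth_default (in_tuple r) j)) /= => ->.
  rewrite rmorphM /f rho_idem mulr1 rho_const => c0; move/eqP: ak => ak.
  have := lring_neq0 (tnth (in_tuple r) k); apply/negP; rewrite negbK; apply/eqP.
  have -> : 1 = stalk_const X (tnth (in_tuple r) k) ((a k)^-1 * a k).
    by rewrite mulVf // rmorph1.
  by rewrite rmorphM /= c0 mulr0.
pose Q m := `[< exists2 r : seq (supp X), uniq r & size r = m >].
have Q0 : exists m, Q m by exists 0%N; apply/asboolP; exists [::].
have QD m : Q m -> (m <= D)%N by move=> /asboolP[r ur <-]; exact: ubound.
case: (ex_maxnP Q0 QD) => m /asboolP[r ur rm] maxm; exists r => // p.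
apply: contrapT => /negP npr; suff /maxm : Q m.+1 by rewrite ltnn.
by apply/asboolP; exists (p :: r); rewrite /= ?npr ?rm.
Qed.

Lemma rho_joint_surj (x : forall p, stalk X p) : exists s, forall p, rho p s = x p.
Proof.
have [r ur rP] := supp_finite.
have /choice[y yP] p : exists s, rho p s = x p by exact: rho_surj.
by exists (\sum_(p <- r) idem p * y p) => p; rewrite rho_sum_idem // rP.
Qed.

(** Let U(l) be the ideal of elements with germ 0 at the points of l. Adding a point p to l cuts out
    a quotient U(l) / U(p :: l) isomorphic to the local ring at p, and U is zero for the full
    support. *)
Lemma aff_dim : dim_mod (aff_const X) setT [set 0] = deg X.
Proof.
have [r ur rP] := supp_finite.
pose U (l : seq (supp X)) : set (aff X) := [set s | forall p, p \in l -> rho p s = 0].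
have sU l : subspace (aff_const X) (U l).
  split=> [p _|s t Us Ut p pl|c s Us p pl]; first by rewrite rmorph0.
    by rewrite rmorphD Us // Ut // addr0.
  by rewrite rmorphM Us // mulr0.
have sT := subspaceT (aff_const X); have s0 := subspace0 (aff_const X).
have fin := aff_finite X_fin.
have U0 : U r = [set 0].
  apply/seteqP; split=> [s Us|s -> p _]; last by rewrite rmorph0.
  by apply: (rho_inj (X_fin := X_fin)) => p; rewrite rmorph0 Us.
have dimU l : uniq l -> dim_mod (aff_const X) setT (U l) =
    (\sum_(p <- l) dim_mod (@stalk_const K n X p) setT [set 0%R : stalk X p])%N.
  elim: l => [_|p l IH /= /andP[pl ul]].
    rewrite big_nil (_ : U [::] = setT) ?dim_modxx //.
    by apply/seteqP; split.
  have sub : U (p :: l) `<=` U l by move=> s Us q ql; apply: Us; rewrite inE ql orbT.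
  rewrite big_cons (@dim_modD _ _ (aff_const X) setT (U l)) //; last first.
    by apply: finite_modS fin => // s ->; by case: (sU (p :: l)).
  rewrite IH // addnC; congr addn.
  apply: (@transfer_dim _ _ _ (aff_const X) (@stalk_const K n X p)
           (fun s x => U l s /\ rho p s = x)) => //.
  - by split; [case: (sU l)|exact: rmorph0].
  - move=> s x t y [Us <-] [Ut <-]; split; last by rewrite rmorphD.
    by case: (sU l) => _ + _; apply.
  - move=> a s x [Us <-]; split; last by rewrite rmorphM rho_const.
    by case: (sU l) => _ _; apply.
  - exact: subspace0.
  - by move=> s Us; exists (rho p s).
  - move=> x _; have [s sx] := rho_surj X_fin x.
    have ps q : q \in l -> rho q (idem p * s) = 0.
      move=> ql; rewrite rmorphM rho_idem_neq ?mul0r // => pq.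
      by move: pl; rewrite pq ql.
    by exists (idem p * s) => //; split=> //; rewrite rmorphM rho_idem mul1r.
  - move=> s x [Us <-]; split=> [Us'|/= s0' q]; first by apply: Us'; rewrite inE eqxx.
    by rewrite inE => /orP[/eqP ->|/Us].
transitivity (dim_mod (aff_const X) setT (U r)); first by rewrite U0.
rewrite (dimU r ur) (fsbig_seq _ _ ur) (_ : [set` r] = setT) //.
by apply/seteqP; split=> p /= _ //; rewrite rP.
Qed.

Lemma hilbert_dim i : hilbert X i = dim_mod (aff_const X) (filt i) [set 0].
Proof. exact: filt_dim. Qed.

Lemma hilbert_deg i : hilbert X i = deg X <-> filt i = [set: aff X].
Proof.
rewrite hilbert_dim -aff_dim; split=> [e|-> //].
have sT := subspaceT (aff_const X); have s0 := subspace0 (aff_const X).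
have sF := filt_subspace X i; have fin := aff_finite X_fin.
have sub0 : [set (0 : aff X)] `<=` filt i by move=> s ->; case: sF.
have := dim_modD sub0 (@subsetT _ _) sT sF s0 fin; rewrite e => /eqP.
rewrite -{1}[dim_mod _ _ _]add0n eqn_add2r eq_sym => /eqP d0.
apply/seteqP; split=> //; apply: (dim_mod0 sT sF _ d0).
exact: finite_modS fin.
Qed.

Lemma filt_reg i : filt i = [set: aff X] <-> (reg_index X <= i)%N.
Proof.
have up k l : (k <= l)%N -> filt k = [set: aff X] -> filt l = [set: aff X].
  by move=> kl e; apply/seteqP; split=> //; rewrite -e; exact: filtS.
have [N Nfull] := filt_full X_fin.
split=> [e|le].
  by apply: natmin_le => j ij; apply/hilbert_deg; exact: up e.
apply/hilbert_deg; move: i le; apply: (natminP (Q := fun r => forall i, (r <= i)%N -> hilbert X i = deg X)).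
by exists N => i le; apply/hilbert_deg; exact: up Nfull.
Qed.

End Decomposition.

(** * Subschemes defined by socle elements *)

Section LocalRing.
Variables (K : fieldType) (n : nat) (X : pscheme K n).
Hypothesis X_fin : affine_finite X.
Local Notation rho := (rho X_fin).

(** A nonunit is the germ of a fraction with numerator in p, to which [off_1B] applies; this is the
    locality of the ring. *)
Lemma nonunit_1B (p : supp X) (x : stalk X p) y : nonunit x -> exists z, (1 - x * y) * z = 1.
Proof.
have [s <-] := rho_surj X_fin x; have [t <-] := rho_surj X_fin y => ns.
have [i [f [hf sf]]] := frac_of_poly s; have [j [g [hg tg]]] := frac_of_poly t.
have pf : f \in pid p.
  apply: contrapT => /negP pf; apply: ns; apply: rho_off.
  by exists i, f.
have -> : 1 - rho p s * rho p t = rho p (1 - s * t) by rewrite rmorphB rmorph1 rmorphM.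
apply: rho_off.
apply: (off_1B X_fin (i := (i + j)%N) (f := f * g)).
- exact: dhomogM.
- by have [_ _ PM _] := pid_homog p; rewrite mulrC; exact: PM.
- by rewrite rmorphM; exact: frac_ofM sf tg.
Qed.

Lemma nonunit_subspace (p : supp X) : subspace (@stalk_const K n X p) (@nonunit (stalk X p)).
Proof.
have not1 x y : nonunit x -> x * y = 1 :> stalk X p -> False by move=> nx xy; apply: nx; exists y.
split=> [[y]|x y nx ny [z xyz]|c x nx [y cxy]].
- by rewrite mul0r => /esym/eqP; apply/negP; exact: lring_neq0.
- have [w wP] := nonunit_1B z nx; apply: (not1 y (z * w) ny).
  by rewrite mulrA -[y * z](addKr (x * z)) -mulrDl xyz addrC.
- by apply: (not1 x (stalk_const X p c * y) nx); rewrite mulrA [x * _]mulrC.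
Qed.

Lemma stalk_finite (p : supp X) : finite_mod (@stalk_const K n X p) setT [set 0].
Proof.
apply: (@transfer_finite _ _ _ (aff_const X) (@stalk_const K n X p) (fun s x => rho p s = x)
  _ _ _ setT [set s | rho p s = 0]).
- exact: rmorph0.
- by move=> s x t y <- <-; exact: rmorphD.
- by move=> c s x <-; rewrite rmorphM rho_const.
- exact: subspaceT.
- exact: rho_kernel_subspace.
- exact: subspaceT.
- exact: subspace0.
- by move=> s _; exists (rho p s).
- by move=> x _; have [s] := rho_surj X_fin x; exists s.
- by move=> s x <-.
- apply: (@finite_modS _ _ (aff_const X) setT setT [set 0]) (aff_finite X_fin) => //.
  + by move=> s ->; exact: rmorph0.
  + exact: rho_kernel_subspace.
Qed.

Lemma resdeg_basis (p : supp X) : exists e : 'I_(resdeg p) -> stalk X p,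
  basis_mod (@stalk_const K n X p) setT (@nonunit (stalk X p)) e.
Proof.
have sN := nonunit_subspace p.
apply: (dim_mod_basis (subspaceT _) sN).
apply: (finite_modS (@subset_refl _ setT) _ (subspaceT _) sN (stalk_finite p)).
by move=> x ->; case: sN.
Qed.

End LocalRing.

Section Subschemes.
Variables (K : fieldType) (n : nat) (X : pscheme K n).
Hypothesis X_fin : affine_finite X.
Local Notation rho := (rho X_fin).
Local Notation P := {mpoly K[n.+1]}.
Local Notation cpi := (coord_pi X).
Implicit Types (f g : P) (s t u v : aff X).

Section IdealScheme.
Variable J : set (aff X).
Hypotheses (J0 : J 0) (JD : forall s t, J s -> J t -> J (s + t))
  (JM : forall s t, J t -> J (s * t)).

Definition ideal_part i : set (coord X) := [set a | exists2 v, J v & frac_of i a v].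

(** The homogenization of J: the polynomials f whose components satisfy f_i / x_0^i in J. *)
Definition ideal_vid : P -> bool :=
  fun f => `[< forall i, ideal_part i (cpi (pihomog mdeg i f)) >].

Lemma ideal_part0 i : ideal_part i 0.
Proof. by exists 0 => //; exact: frac_of0. Qed.

Lemma ideal_partD i a b : ideal_part i a -> ideal_part i b -> ideal_part i (a + b).
Proof. by move=> [v Jv av] [w Jw bw]; exists (v + w); [exact: JD|exact: frac_ofD]. Qed.

Lemma ideal_vid_homog : homog_ideal ideal_vid.
Proof.
split.
- by apply/asboolP => i; rewrite raddf0 rmorph0; exact: ideal_part0.
- move=> f g /asboolP If /asboolP Ig; apply/asboolP => i; rewrite pihomogD rmorphD.
  exact: ideal_partD.
- move=> f g /asboolP Ig; apply/asboolP => i.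
  rewrite {1}(pihomog_sum (leqnn (msize f))) mulr_suml (raddf_sum (pihomog mdeg i)) (raddf_sum cpi) /=.
  elim/big_ind: _ => [|x y|d _]; [exact: ideal_part0|exact: ideal_partD|].
  rewrite (pihomogM_homog _ _ (pihomogP mdeg d f)); case: leqP => [di|_]; last first.
    by rewrite rmorph0; exact: ideal_part0.
  have [v Jv gv] := Ig (i - d)%N.
  have fd := dehomP X_fin (coord_degP X (pihomogP mdeg d f)).
  exists (dehom d (cpi (pihomog mdeg d f)) * v); first exact: JM.
  by rewrite -{1}(subnKC di) rmorphM; exact: frac_ofM.
- move=> f d /asboolP If; apply/asboolP => i.
  have [->|ne] := eqVneq d i; first by rewrite pihomog_id.
  by rewrite (pihomog_ne0 ne (pihomogP mdeg d f)) rmorph0; exact: ideal_part0.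
Qed.

(** Testing X_0^d alone suffices, since f_i and X_0^d f_i define the same fraction. *)
Lemma ideal_vid_sat f d :
  (forall m : 'X_{1..n.+1}, mdeg m = d -> 'X_[m] * f \in ideal_vid) -> f \in ideal_vid.
Proof.
move=> /(_ (U_(ord0) *+ d)%MM); rewrite mdegMn mdeg1 mul1n => /(_ erefl) /asboolP If.
have hX : ('X_[U_(ord0) *+ d] : P) \is d.-homog.
  by rewrite dhomogX; apply/eqP; apply: etrans (mdegMn _ _) _; rewrite mdeg1 mul1n.
apply/asboolP => i; have [v Jv H] := If (d + i)%N; exists v => //.
move: H; rewrite (pihomogM_homog _ _ hX) leq_addr addKn -mpolyXn rmorphM rmorphXn => fv.
have fi := dehomP X_fin (coord_degP X (pihomogP mdeg i f)).
rewrite (_ : v = dehom i (cpi (pihomog mdeg i f))) //.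
by apply: (frac_of_uniq X_fin fv); rewrite mulrC addnC; exact: frac_of_shift.
Qed.

Definition ideal_scheme : pscheme K n := PScheme ideal_vid_homog ideal_vid_sat.

Lemma ideal_schemeP i f v : f \is i.-homog -> frac_of i (cpi f) v ->
  vid ideal_scheme f <-> J v.
Proof.
move=> hf vf; split=> [/asboolP/(_ i)|Jv].
  by rewrite pihomog_dE // => -[w Jw wf]; rewrite (frac_of_uniq X_fin vf wf).
apply/asboolP => j; have [<-|ne] := eqVneq i j; first by rewrite pihomog_dE //; exists v.
by rewrite (pihomog_ne0 ne hf) rmorph0; exact: ideal_part0.
Qed.

Lemma ideal_scheme_sub : subscheme ideal_scheme X.
Proof.
move=> f If; apply/asboolP => i.
have fi : pihomog mdeg i f \in vid X by have [_ _ _] := vid_homog X; apply.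
by rewrite ((coord_pi_eq0 X _).2 fi); exact: ideal_part0.
Qed.

End IdealScheme.

Section Subscheme.
Variable Y : pscheme K n.
Hypothesis YX : subscheme Y X.

Lemma subscheme_affine_finite : affine_finite Y.
Proof.
have onX q : on_scheme Y q -> on_scheme X q by move=> Yq f /YX/Yq.
split=> [p q /onX Xp /onX Xq|q]; first by case: X_fin => inc _; exact: inc.
by apply: (on_scheme_x0 X_fin); apply: onX; exact: supp_on.
Qed.

(** The restriction map from R_X to R_Y is [coord_pi Y (repr a)], independent of the representative
    since I_X lies in I_Y. *)
Lemma coord_res f : coord_pi Y (repr (cpi f)) = coord_pi Y f.
Proof. by apply/coord_piP; apply: YX; exact: coord_reprP. Qed.

Lemma coord_resB (a b : coord X) :
  coord_pi Y (repr (a - b)) = coord_pi Y (repr a) - coord_pi Y (repr b).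
Proof.
by rewrite -(coord_piK a) -(coord_piK b) -rmorphB !coord_res rmorphB.
Qed.

Lemma coord_resM (a b : coord X) :
  coord_pi Y (repr (a * b)) = coord_pi Y (repr a) * coord_pi Y (repr b).
Proof.
by rewrite -(coord_piK a) -(coord_piK b) -rmorphM !coord_res rmorphM.
Qed.

Lemma coord_res_off (q : ppoint K n) (a : coord X) :
  off_point q a -> off_point q (coord_pi Y (repr a)).
Proof. by move=> [d [f [hf qf ->]]]; exists d, f; rewrite coord_res. Qed.

(** [stalk_map] uses the chosen representative of a germ. Any other fraction f / g gives the same
    result, as the element w witnessing equality on X restricts to one on Y. *)
Lemma stalk_mapP (q : ppoint K n) d f g (x : stalk X q) :
  f \is d.-homog -> g \is d.-homog -> g \notin pid q ->
  val x * to_loc _ (cpi g) = to_loc (off_mulset X q) (cpi f) ->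
  val (stalk_map Y x) * to_loc _ (coord_pi Y g) = to_loc (off_mulset Y q) (coord_pi Y f).
Proof.
move=> hf hg qg xE; set a := num (repr (val x)); set b := den (repr (val x)).
have qb : off_point q b := denP (repr (val x)).
have qgX : off_point q (cpi g) by exists d, g.
have qgY : off_point q (coord_pi Y g) by exists d, g.
have xab : val x * to_loc _ b = to_loc (off_mulset X q) a := fracpairK (val x).
have /to_loc_eq0[w qw we] : to_loc (off_mulset X q) (a * cpi g - cpi f * b) = 0.
  by rewrite rmorphB !rmorphM /= -xE -xab mulrAC subrr.
have e : to_loc (off_mulset Y q) (coord_pi Y (repr a)) * to_loc _ (coord_pi Y g)
       = to_loc _ (coord_pi Y f) * to_loc _ (coord_pi Y (repr b)).
  apply/eqP; rewrite -subr_eq0 -!rmorphM -rmorphB; apply/eqP/to_loc_eq0.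
  exists (coord_pi Y (repr w)); first exact: coord_res_off.
  have := congr1 (fun z => coord_pi Y (repr z)) we.
  have r0 : coord_pi Y (repr (0 : coord X)) = 0 by rewrite -(coord_pi0 X) coord_res rmorph0.
  by rewrite /= r0 coord_resM coord_resB !coord_resM !coord_res !(rmorphM (coord_pi Y)).
have fr : loc_frac (off_mulset Y q) (coord_pi Y (repr a)) (coord_pi Y (repr b))
        = loc_frac (off_mulset Y q) (coord_pi Y f) (coord_pi Y g).
  apply/(loc_fracP (S := off_mulset Y q)) => //.
  apply: (to_loc_cancel (S := off_mulset Y q) (coord_res_off qb)).
  by rewrite mulrAC (loc_fracK (S := off_mulset Y q)) //; exact: (coord_res_off qb).
rewrite (_ : stalk_map Y x = stalk_frac q (coord_pi Y f) (coord_pi Y g)).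
  by apply: (stalk_fracP (d := d)) => //; exact: coord_degP.
by rewrite /stalk_map /stalk_frac fr.
Qed.

Lemma stalk_map_surj (q : ppoint K n) (y : stalk Y q) : exists x, @stalk_map K n X Y q x = y.
Proof.
have [d [_ [b [[f hf ->] db pb yE]]]] := stalk_rep y.
have [e [g [hg qg bE]]] := pb.
(* The form g over the denominator b may have another degree than d. Then b is homogeneous of two
   degrees, so b = 0 is off q and the local ring of Y is zero. *)
have [de|ne] := eqVneq d e; last first.
  exists 0; apply: (stalk_cancel pb).
  have -> : b = 0.
    have eb : coord_deg e b by rewrite bE; exact: coord_degP.
    have := coord_comp_id e db; rewrite (negPf ne) => <-.
    by rewrite (coord_comp_id e eb) eqxx.
  by rewrite rmorph0 !mulr0.
rewrite {}bE in yE pb db; subst e.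
have qgX : off_point q (cpi g) by exists d, g.
exists (stalk_frac q (cpi f) (cpi g)); apply: (stalk_cancel pb); rewrite yE.
apply: (stalk_mapP hf hg qg); apply: (stalk_fracP (d := d)) => //; exact: coord_degP.
Qed.

End Subscheme.

Section SocleSubscheme.
Variables (p : supp X) (t : aff X).
Hypotheses (t_neq0 : rho p t <> 0) (t_supp : forall q, q <> p -> rho q t = 0)
  (t_socle : forall x : stalk X p, nonunit x -> x * rho p t = 0).

Definition principal : set (aff X) := [set v | exists u, v = u * t].

Lemma principal0 : principal 0.
Proof. by exists 0; rewrite mul0r. Qed.

Lemma principalD u v : principal u -> principal v -> principal (u + v).
Proof. by move=> [a ->] [b ->]; exists (a + b); rewrite mulrDl. Qed.

Lemma principalM u v : principal v -> principal (u * v).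
Proof. by move=> [a ->]; exists (u * a); rewrite mulrA. Qed.

Lemma principal_subspace : subspace (aff_const X) principal.
Proof. by split; [exact: principal0|exact: principalD|move=> *; exact: principalM]. Qed.

Definition socle_scheme : pscheme K n := ideal_scheme principal0 principalD principalM.
Local Notation Y := socle_scheme.

Let YX : subscheme Y X := ideal_scheme_sub principal0 principalD principalM.

Lemma socle_schemeP i f v : f \is i.-homog -> frac_of i (cpi f) v -> vid Y f <-> principal v.
Proof. exact: ideal_schemeP. Qed.

Lemma mul_socle_eq0 u : nonunit (rho p u) -> u * t = 0.
Proof.
move=> nu; apply: (rho_inj (X_fin := X_fin)) => q; rewrite rmorphM rmorph0.
have [->|/eqP qp] := eqVneq q p; first exact: t_socle.
by rewrite (t_supp qp) mulr0.
Qed.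

(** The local ring of Y at q is thus the localization of S / St, here with the elements of [off q]
    as denominators. *)
Lemma stalk_map_eq (q : supp X) u v :
  stalk_map Y (rho q u) = stalk_map Y (rho q v) <->
  exists w, off q w /\ principal (w * (u - v)).
Proof.
have [i [a ua]] := frac_of_exists u; have [j [b vb]] := frac_of_exists v.
have {}ua := frac_of_shift j ua; have {vb} := frac_of_shift i vb; rewrite addnC => vb.
move: (i + j)%N (a * _) (b * _) ua vb => {i j a b} i _ _ [[f hf ->] uf'] [[g hg ->] vg'].
have uf : frac_of i (cpi f) u by split=> //; exact: coord_degP.
have vg : frac_of i (cpi g) v by split=> //; exact: coord_degP.
have hX : ('X_ord0 ^+ i : P) \is i.-homog.
  by rewrite -[i in _ \is i.-homog]mul1n; apply: dhomogMn; exact: dhomog_var.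
have qX : 'X_ord0 ^+ i \notin pid q.
  by apply/negP => /pid_exp; apply/negP; case: X_fin => _; exact.
have qY : off_point q (coord_pi Y ('X_ord0 ^+ i)) by exists i, ('X_ord0 ^+ i).
have := rhoP X_fin q uf; rewrite -rmorphXn => /(stalk_mapP YX hf hX qX) uE.
have := rhoP X_fin q vg; rewrite -rmorphXn => /(stalk_mapP YX hg hX qX) vE.
have fgu : frac_of i (cpi (f - g)) (u - v) by rewrite rmorphB; exact: frac_ofB.
split=> [e|[w [[j [h [hh qh wh]]] Jw]]].
  have /to_loc_eq0[_ [j [h [hh qh ->]]] hfg] :
      to_loc (off_mulset Y q) (coord_pi Y (f - g)) = 0.
    by rewrite !rmorphB /= -uE -vE e subrr.
  have wh := dehomP X_fin (coord_degP X hh).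
  exists (dehom j (cpi h)); split; first by exists j, h.
  apply: (iffLR (socle_schemeP (dhomogM hh (rpredB hf hg)) _)).
    by rewrite rmorphM; exact: frac_ofM wh fgu.
  by apply/coord_pi_eq0; rewrite rmorphM.
apply: (stalk_cancel qY); rewrite uE vE; apply/eqP; rewrite -subr_eq0 -!rmorphB.
apply/eqP/to_loc_eq0; exists (coord_pi Y h); first by exists j, h.
rewrite -rmorphM; apply/coord_pi_eq0.
apply: (iffRL (socle_schemeP (dhomogM hh (rpredB hf hg)) _) Jw).
by rewrite rmorphM; exact: frac_ofM wh fgu.
Qed.

(** The germ of t at q is 0, so w (u - v) in St with w off q forces u and v to have equal germs on
    X. *)
Lemma socle_stalk_bij (q : supp X) : q <> p -> bijective (@stalk_map K n X Y q).
Proof.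
move=> qp; have /choice[h hP] := @stalk_map_surj Y YX q.
exists h => // x; have := hP (stalk_map Y x).
have [u <-] := rho_surj X_fin x; have [v <-] := rho_surj X_fin (h (stalk_map Y (rho q u))).
move=> /esym /stalk_map_eq[w [ow [z wz]]].
have [y wy] := rho_off X_fin ow; apply/eqP; rewrite eq_sym -subr_eq0 -[_ - _]mul1r -wy mulrAC.
by rewrite -rmorphB -rmorphM wz rmorphM (t_supp qp) mulr0 mul0r.
Qed.

Lemma socle_kernel (x : stalk X p) : stalk_map Y x = 0 <-> exists y, x = y * rho p t.
Proof.
have z0 : 0 = stalk_map Y (rho p 0).
  rewrite rmorph0; apply: (stalk_cancel (off_point1 Y p)).
  rewrite rmorph0 mul0r; apply: esym.
  have := @stalk_mapP Y YX p 0 0 1 0; rewrite !rmorph0 !rmorph1; apply.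
  - exact: dhomog0.
  - exact: dhomog1.
  - exact: pid1.
  - by rewrite mul0r.
rewrite z0; split=> [|[y ->]].
  have [u <-] := rho_surj X_fin x; move=> /stalk_map_eq[w [ow [z]]]; rewrite subr0 => wz.
  have [y wy] := rho_off X_fin ow; exists (y * rho p z).
  by rewrite -[LHS]mul1r -wy mulrAC -rmorphM wz rmorphM mulrC mulrA.
have [v <-] := rho_surj X_fin y; rewrite -rmorphM; apply/stalk_map_eq.
by exists 1; split; [exact: off1|exists v; rewrite mul1r subr0].
Qed.

(** In a degree N where both filtrations are full, the kernel of the restriction from R_{X,N} to
    R_{Y,N} corresponds to St. *)
Lemma socle_scheme_deg : dim_mod (aff_const X) setT principal = deg Y.
Proof.
have Y_fin := subscheme_affine_finite YX.
have [N1 full1] := filt_full X_fin; have [N2 full2] := filt_full Y_fin.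
pose N := maxn N1 N2.
have fullX : filt N = [set: aff X].
  by apply/seteqP; split=> //; rewrite -full1; apply: filtS; exact: leq_maxl.
have fullY : filt N = [set: aff Y].
  by apply/seteqP; split=> //; rewrite -full2; apply: filtS; exact: leq_maxr.
rewrite -((hilbert_deg Y_fin N).2 fullY) -fullX.
apply: (@transfer_dim _ _ _ (aff_const X) (@coord_const K n Y)
  (fun v b => exists f, [/\ f \is N.-homog, frac_of N (cpi f) v & b = coord_pi Y f])).
- by exists 0; rewrite !rmorph0 dhomog0; split=> //; exact: frac_of0.
- move=> u b v c [f [hf uf ->]] [g [hg vg ->]]; exists (f + g).
  by rewrite !rmorphD rpredD //; split=> //; exact: frac_ofD.
- move=> c u b [f [hf uf ->]]; exists (c%:MP * f); rewrite !rmorphM; split=> //.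
    by rewrite mul_mpolyC rpredZ.
  exact: frac_ofZ.
- exact: filt_subspace.
- exact: principal_subspace.
- exact: coord_deg_subspace.
- exact: subspace0.
- move=> v [_ [[f hf ->] vf]]; exists (coord_pi Y f); first exact: coord_degP.
  by exists f; split=> //; split=> //; exact: coord_degP.
- move=> _ [f hf ->]; have ff := dehomP X_fin (coord_degP X hf).
  by exists (dehom N (cpi f)); [exists (cpi f)|exists f].
- move=> v _ [f [hf vf ->]]; apply: iff_trans (iff_sym (socle_schemeP hf vf)) _.
  exact: iff_sym (coord_pi_eq0 Y f).
Qed.

(** The annihilator of t consists of the u with nonunit germ at p, so St is isomorphic to the
    residue field. *)
Lemma principal_dim : dim_mod (aff_const X) principal [set 0] = resdeg p.
Proof.
apply: esym; apply: (@transfer_dim _ _ _ (@stalk_const K n X p) (aff_const X)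
  (fun x v => exists u, x = rho p u /\ v = u * t)).
- by exists 0; rewrite rmorph0 mul0r.
- by move=> x v y w [a [-> ->]] [b [-> ->]]; exists (a + b); rewrite rmorphD mulrDl.
- by move=> c x v [a [-> ->]]; exists (aff_const X c * a); rewrite rmorphM rho_const mulrA.
- exact: subspaceT.
- exact: nonunit_subspace.
- exact: principal_subspace.
- exact: subspace0.
- by move=> x _; have [u <-] := rho_surj X_fin x; exists (u * t); exists u.
- by move=> _ [u ->]; exists (rho p u) => //; exists u.
- move=> _ _ [u [-> ->]]; split=> [/mul_socle_eq0 //|/= ut [y uy]]; apply: t_neq0.
  by rewrite -[LHS]mul1r -uy mulrAC -rmorphM ut rmorph0 mul0r.
Qed.

Lemma socle_scheme_maximal : maximal_point_subscheme p Y.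
Proof.
split; first split=> //; [exact: socle_stalk_bij|exact: stalk_map_surj|].
rewrite -socle_scheme_deg -principal_dim -(aff_dim X_fin).
have s0 := subspace0 (aff_const X); have sT := subspaceT (aff_const X).
apply: esym; apply: (dim_modD _ _ sT principal_subspace s0 (aff_finite X_fin)) => //.
by move=> s ->; exact: principal0.
Qed.

Lemma socle_scheme_generator : @socle_generator K n X p Y (rho p t).
Proof.
split; [exact/eqP|exact: t_socle|exact: socle_kernel].
Qed.

End SocleSubscheme.
End Subschemes.

(** * The Cayley-Bacharach property *)

Section CayleyBacharach.
Variables (K : fieldType) (n : nat) (X : pscheme K n).
Hypothesis X_fin : affine_finite X.
Local Notation rho := (rho X_fin).
Implicit Types (p q : supp X) (s t u v : aff X).

Definition supported_at p t : Prop := forall q, q <> p -> rho q t = 0.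

Lemma supported_atM p u t : supported_at p t -> supported_at p (u * t).
Proof. by move=> pt q /pt e; rewrite rmorphM e mulr0. Qed.

Lemma lift_at p (x : stalk X p) : exists2 t, rho p t = x & supported_at p t.
Proof.
have [s <-] := rho_surj X_fin x; exists (idem X_fin p * s).
  by rewrite rmorphM rho_idem mul1r.
by move=> q /nesym qp; rewrite rmorphM rho_idem_neq ?mul0r.
Qed.

Lemma supported_at_inj p s t : supported_at p s -> supported_at p t ->
  rho p s = rho p t -> s = t.
Proof.
move=> ps pt e; apply: (rho_inj (X_fin := X_fin)) => q.
by have [->|/eqP qp] := eqVneq q p; rewrite // ps // pt.
Qed.

(** The truncation in [itilde] is harmless: beyond its bound the components of a vanish. *)
Lemma itilde_coef (a : coord X) p i : (itilde a p)`_i = rho p (dehom i (coord_comp i a)).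
Proof.
rewrite (rho_germ X_fin p (dehomP X_fin (coord_comp_deg i a))) coef_poly.
case: ltnP => // /coord_comp_ge a0.
rewrite -(rho_germ X_fin p (dehomP X_fin (coord_comp_deg i a))) a0.
by rewrite (dehomE X_fin (frac_of0 X i)) rmorph0.
Qed.

(** This turns the condition minimized by [mu] into membership in the filtration. *)
Lemma muP p t i : supported_at p t ->
  (exists f : coord X, itilde f p = (rho p t : lring p) *: 'X^i /\ forall q, q <> p -> itilde f q = 0)
  <-> filt i t.
Proof.
move=> pt; split=> [[f [fp fq]]|[a at_]].
  have fi := dehomP X_fin (coord_comp_deg i f).
  suff -> : t = dehom i (coord_comp i f) by exists (coord_comp i f).
  apply: (rho_inj (X_fin := X_fin)) => q; rewrite -itilde_coef.
  have [->|/eqP qp] := eqVneq q p; last by rewrite fq // coef0 pt.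
  by rewrite fp coefZ coefXn eqxx mulr1.
have ia : coord_deg i a by case: at_.
have coef q j : (itilde a q)`_j = if i == j then rho q t else 0.
  rewrite itilde_coef (coord_comp_id j ia); case: eqVneq => [<-|_].
    by rewrite (dehomE X_fin at_).
  by rewrite (dehomE X_fin (frac_of0 X j)) rmorph0.
exists a; split=> [|q qp]; apply/polyP => j; rewrite coef ?coef0.
  by rewrite coefZ coefXn eq_sym; case: eqP; rewrite ?mulr1 ?mulr0.
by rewrite pt //; case: ifP.
Qed.

Lemma mu_le p t i : supported_at p t -> filt i t -> (mu (rho p t : lring p) <= i)%N.
Proof. by move=> pt ti; apply: natmin_le; apply/(muP i pt). Qed.

Lemma filt_mu p t i : supported_at p t -> (mu (rho p t : lring p) <= i)%N -> filt i t.
Proof.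
move=> pt le; apply: (filtS le); apply/(muP _ pt).
pose Q i := exists f : coord X,
  itilde f p = (rho p t : lring p) *: 'X^i /\ forall q, q <> p -> itilde f q = 0.
apply: (natminP (Q := Q)).
by have [j [a ta]] := frac_of_exists t; exists j; apply/(muP _ pt); exists a.
Qed.

Lemma principal_sub u t : principal (u * t) `<=` principal t.
Proof. by move=> _ [v ->]; exists (v * u); rewrite mulrA. Qed.

(** Take St of least dimension among the nonzero principal ideals inside Sa supported at p. If a
    nonunit germ x, lifted to s, had x t nonzero, minimality would give St = S s t, say t = z s t;
    but 1 - z s is a unit at p, so t would have germ 0. *)
Lemma socle_exists p a : rho p a <> 0 -> exists t,
  [/\ principal a t, rho p t <> 0, supported_at p t
    & forall x : stalk X p, nonunit x -> x * rho p t = 0].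
Proof.
move=> a0.
pose Q d := `[< exists t, [/\ principal a t, rho p t <> 0, supported_at p t
  & dim_mod (aff_const X) (principal t) [set 0] = d] >].
have Q0 : exists d, Q d.
  exists (dim_mod (aff_const X) (principal (idem X_fin p * a)) [set 0]).
  apply/asboolP; exists (idem X_fin p * a); split=> //; first by exists (idem X_fin p).
    by rewrite rmorphM rho_idem mul1r.
  by move=> q /nesym qp; rewrite rmorphM rho_idem_neq ?mul0r.
case: (ex_minnP Q0) => d /asboolP[t [at_ t0 pt dt]] mind; exists t; split=> // x nx.
apply: contrapT; have [s sx] := rho_surj X_fin x; rewrite -sx -rmorphM => st0.
have /mind : Q (dim_mod (aff_const X) (principal (s * t)) [set 0]).
  by apply/asboolP; exists (s * t); split=> //; [exact: principalM|exact: supported_atM].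
have s0 := subspace0 (aff_const X).
have sub0 v : [set 0] `<=` principal v by move=> _ ->; exact: principal0.
have fin v : finite_mod (aff_const X) (principal v) [set 0].
  by apply: finite_modS (aff_finite X_fin) => //; exact: principal_subspace.
have := dim_modD (sub0 _) (@principal_sub s t) (principal_subspace t)
  (principal_subspace (s * t)) s0 (fin t).
rewrite dt => -> ; rewrite -{2}[dim_mod _ (principal (s * t)) _]add0n leq_add2r leqn0 => /eqP d0.
have [z tz] : principal (s * t) t.
  apply: (dim_mod0 (principal_subspace t) (principal_subspace (s * t)) _ d0).
    by apply: finite_modS (fin t) => //; exact: principal_subspace.
  by exists 1; rewrite mul1r.
have [y xzy] := nonunit_1B X_fin (rho p z) nx.
apply: t0; rewrite -[LHS]mul1r -xzy mulrAC mulrBl mul1r -sx {1}tz !rmorphM.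
by rewrite mulrCA mulrA subrr mul0r.
Qed.

(** An ideal is nonzero iff it contains a nonzero principal ideal, so only ideals St are tested. *)
Definition no_ideal_below i : Prop :=
  forall j t, (j < i)%N -> (forall u, filt j (u * t)) -> t = 0.

(** Nonunits kill the socle element, so the products e_k t span St over K. *)
Lemma mu_subscheme_filt p Y m t : supported_at p t ->
  forall e : 'I_(resdeg p) -> lring p, @socle_generator K n X p Y (rho p t) ->
  basis_mod (@stalk_const K n X p) setT (@nonunit (stalk X p)) e ->
  (\max_(k < resdeg p) mu (e k * (rho p t : lring p))%R <= m)%N <-> (forall u, filt m (u * t)).
Proof.
move=> pt e [_ soc _] be; have [_ span _] := iffLR (basis_modP e (subspaceT _) (nonunit_subspace X_fin p)) be.
have /choice[v vP] k : exists v, rho p v = e k by exact: rho_surj.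
split=> [/bigmax_leqP le u|tm].
  have [a /soc] := span (rho p u) I.
  rewrite mulrBl => /eqP; rewrite subr_eq0 => /eqP uE.
  have -> : u * t = \sum_k aff_const X (a k) * (v k * t).
    apply: (supported_at_inj (p := p)); first exact: supported_atM.
      move=> q qp; rewrite rmorph_sum big1 // => k _.
      by rewrite !rmorphM (pt q qp) !mulr0.
    rewrite rmorphM; apply: etrans uE _; rewrite /lincomb mulr_suml rmorph_sum.
    by apply: eq_bigr => k _; rewrite !rmorphM rho_const vP mulrA.
  have [F0 FD FZ] := filt_subspace X m.
  elim/big_ind: _ => // k _; apply: FZ; apply: (filt_mu (p := p)).
    exact: supported_atM.
  by rewrite rmorphM vP; exact: le.
apply/bigmax_leqP => k _; rewrite -vP -rmorphM.
by apply: mu_le; [exact: supported_atM|exact: tm].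
Qed.

Lemma degree_at_witness p t : rho p t <> 0 -> supported_at p t ->
  (forall x : stalk X p, nonunit x -> x * rho p t = 0) ->
  exists Y m, [/\ maximal_point_subscheme p Y, mu_subscheme p Y m
    & forall i, (m <= i)%N <-> (forall u, filt i (u * t))].
Proof.
move=> t0 pt soc; have [e be] := resdeg_basis X_fin p.
exists (socle_scheme X_fin t), (\max_(k < resdeg p) mu (e k * (rho p t : lring p))%R)%N.
have gen := socle_scheme_generator t0 soc.
split; first exact: socle_scheme_maximal.
  by exists (rho p t), e; split.
move=> i; exact: mu_subscheme_filt gen be.
Qed.

(** A nonzero St inside F_j contains a nonzero socle element, whose subscheme has mu at most j.
    Conversely, without ideals below r every mu_{Y/X} is at least r, and F_r = S makes r the value
    for the subscheme of any socle element. *)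
Lemma cayley_bacharach_filt : cayley_bacharach X <-> no_ideal_below (reg_index X).
Proof.
split=> [CB j t jr tj|none p].
  apply: (rho_inj (X_fin := X_fin)) => p; rewrite rmorph0; apply: contrapT => t0.
  have [v [[z ->] v0 pv soc]] := socle_exists t0.
  have [Y [m [Ymax Ym mle]]] := degree_at_witness v0 pv soc.
  have : (m <= j)%N by apply/mle => u; rewrite mulrA; exact: tj.
  have : (degree_at p <= m)%N by apply: natmin_le; exists Y.
  by rewrite CB => rm mj; move: jr; rewrite ltnNge (leq_trans rm mj).
have full u : filt (reg_index X) u by have /(filt_reg X_fin) -> := leqnn (reg_index X).
have lower Y m : mu_subscheme p Y m -> (reg_index X <= m)%N.
  move=> [s [e [gen be ->]]]; have [t ts pt] := lift_at s.
  move: gen; rewrite -ts => gen; have [/eqP t0 _ _] := gen.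
  rewrite leqNgt; apply/negP => lt; apply: t0.
  rewrite (none _ t lt) ?rmorph0 //.
  by apply/(mu_subscheme_filt _ pt gen be).
have [v [_ v0 pv soc]] : exists t, [/\ principal 1 t, rho p t <> 0, supported_at p t
    & forall x : stalk X p, nonunit x -> x * rho p t = 0].
  by apply: socle_exists; rewrite rmorph1; apply/eqP; exact: lring_neq0.
have [Y [m [Ymax Ym mle]]] := degree_at_witness v0 pv soc.
apply: natmin_eq => [|l [Z _ Zl]]; last exact: lower Zl.
suff -> : reg_index X = m by exists Y.
by apply/eqP; rewrite eqn_leq (lower _ _ Ym); apply/mle.
Qed.

End CayleyBacharach.

(** * The conductor *)

Section Conductor.
Variables (K : fieldType) (n : nat) (X : pscheme K n).
Hypothesis X_fin : affine_finite X.
Local Notation rho := (rho X_fin).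
Local Notation r := (reg_index X).

(** Multiplying f by the constants coming from u in S shows that the ideal generated by f_i / x_0^i
    lies in F_i. *)
Lemma conductor_coord_ge (f : coord X) : no_ideal_below X r -> conductor (itilde f) -> coord_ge r f.
Proof.
move=> none cf; apply/coord_geP => i ir.
apply: (dehom_eq0 X_fin (coord_comp_deg i f)); apply: (none i _ ir) => u.
have [a fu] := cf (fun p => (rho p u : lring p)%:P).
have -> : u * dehom i (coord_comp i f) = dehom i (coord_comp i a).
  apply: (rho_inj (X_fin := X_fin)) => p.
  rewrite mulrC rmorphM -!itilde_coef -fu /Rtilde_mul coefMC.
  by [].
by exists (coord_comp i a); apply: (dehomP X_fin); exact: coord_comp_deg.
Qed.

(** A product with f has no components below degree r, and from degree r on every family of germs
    comes from R_i. *)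
Lemma coord_ge_conductor (f : coord X) : coord_ge r f -> conductor (itilde f).
Proof.
move=> /coord_geP f0 g; pose h := Rtilde_mul (itilde f) g.
(* The support is finite, so the degrees in h are bounded and its preimage is a finite sum. *)
have [l _ lP] := supp_finite X_fin; pose B := \max_(p <- l) size (h p).
have hB p i : (B <= i)%N -> (h p)`_i = 0.
  move=> Bi; apply: nth_default; apply: leq_trans Bi.
  by rewrite /B (big_rem p) ?lP // leq_maxl.
have /choice[a aP] i : exists a, coord_deg i a /\ forall p, rho p (dehom i a) = (h p)`_i.
  have [s sP] := rho_joint_surj X_fin (fun p => (h p)`_i).
  have [ri|ir] := leqP r i.
    have [a sa] : filt i s by have /(filt_reg X_fin) -> := ri.
    by exists a; split=> [|p]; [case: sa|rewrite (dehomE X_fin sa)].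
  exists 0; split=> [|p]; first by case: (coord_deg_subspace X i).
  rewrite (dehomE X_fin (frac_of0 X i)) rmorph0 /h /Rtilde_mul coefM big1 // => j _.
  rewrite (itilde_coef X_fin) f0 ?(dehomE X_fin (frac_of0 X j)) ?rmorph0 ?mul0r //.
  by rewrite (leq_ltn_trans _ ir) // -ltnS ltn_ord.
exists (\sum_(i < B) a i); apply: functional_extensionality_dep => p; apply/polyP => i.
rewrite (itilde_coef X_fin) coord_comp_sum => [|j]; last by case: (aP j).
case: ltnP => [_|/hB ->]; first by rewrite (proj2 (aP i)).
by rewrite (dehomE X_fin (frac_of0 X i)) rmorph0.
Qed.

Lemma coord_geM d e (a b : coord X) : coord_ge d a -> coord_ge e b -> coord_ge (d + e) (a * b).
Proof.
move=> /coord_geP da /coord_geP eb; apply/coord_geP => i ide.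
rewrite (coord_sum_comp (leqnn (msize (repr a)))) mulr_suml raddf_sum big1 // => j _ /=.
rewrite (coord_compM _ _ (coord_comp_deg j a)); case: leqP => // ji.
have [jd|dj] := ltnP j d; first by rewrite da // mul0r.
by rewrite eb ?mulr0 //; lia.
Qed.

Lemma conductor_sq_ge : no_ideal_below X r -> conductor_sq X = @coord_ge K n X (2 * r).
Proof.
move=> none; apply/seteqP; split=> [_ [m [f [g [cf cg ->]]]]|a /coord_geP a0].
  apply/coord_geP => i ir; rewrite raddf_sum big1 // => k _.
  have fr := conductor_coord_ge none (cf k); have gr := conductor_coord_ge none (cg k).
  by have /coord_geP := coord_geM fr gr; rewrite addnn -mul2n; apply.
(* For i >= r both F_i and F_{r+i} are S, hence R_{r+i} = x_0^r R_i. *)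
have /choice[b bP] i : exists b, coord_deg i b /\ ((r <= i)%N -> coord_comp (r + i) a = x0 X ^+ r * b).
  have sa := dehomP X_fin (coord_comp_deg (r + i) a).
  have [ri|_] := leqP r i; last by exists 0; split=> //; case: (coord_deg_subspace X i).
  have [b sb] : filt i (dehom (r + i) (coord_comp (r + i) a)) by have /(filt_reg X_fin) -> := ri.
  exists b; split=> [|_]; first by case: sb.
  by have := frac_of_shift r sb; rewrite [(i + r)%N]addnC [b * _]mulrC => /(frac_of_inj sa).
(* Here b' is a / x_0^r, so a is a single product of two conductor elements. The bound M loses
   nothing, as a has no component of degree M or more. *)
pose M := msize (repr a); pose b' := \sum_(i < M | (r <= i)%N) b i.
have b'E i : coord_comp i b' = if (i < M)%N && (r <= i)%N then b i else 0.
  rewrite /b' big_mkcond /= (coord_comp_sum M (F := fun i => if (r <= i)%N then b i else 0)) => [|j].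
    by case: ifP => //= _; case: ifP.
  by case: ifP => _; [case: (bP j)|case: (coord_deg_subspace X j)].
exists 1%N, (fun=> x0 X ^+ r), (fun=> b'); split=> [_|_|].
- apply: coord_ge_conductor; apply/coord_geP => i ir.
  by rewrite (coord_comp_id _ (coord_deg_x0X X r)) gtn_eqF.
- apply: coord_ge_conductor; apply/coord_geP => i ir.
  by rewrite b'E [(r <= i)%N]leqNgt ir andbF.
- rewrite big_ord1; apply: coord_comp_ext => i.
  rewrite (coord_compM _ _ (coord_deg_x0X X r)) b'E.
  have [ri|ir] := leqP r i; last by rewrite a0 //; lia.
  have [ri2|ir2] := leqP r (i - r); last by rewrite andbF mulr0 a0 //; lia.
  rewrite andbT; have [_|iM] := ltnP (i - r) M; first by rewrite -(proj2 (bP _)) // subnKC.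
  by rewrite mulr0 coord_comp_ge // (leq_trans iM) // leq_subr.
Qed.

End Conductor.

(** * The Dedekind different *)

Section Different.
Variables (K : fieldType) (n : nat) (X : pscheme K n).
Hypothesis X_fin : affine_finite X.
Local Notation r := (reg_index X).
Local Notation xi := (toQh X (x0 X)).
Implicit Types (q : Qh X) (s t u v : aff X).

Lemma frac_of_toQh i a s : frac_of i a s -> val s * xi ^+ i = toQh X a.
Proof. by case. Qed.

(** The fraction u = b / x_0^d is invertible in Q^h(R), so its idempotent is 1 and u is already
    invertible in S. This is the equality of Q^h(R) with R_{x_0}. *)
Lemma hnzd_inverse d (b : coord X) : coord_deg d b -> hnzd b ->
  exists v, val v * toQh X b = xi ^+ d.
Proof.
move=> db hb; have ub := dehomP X_fin db; set u := dehom d b in ub.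
have [e [v [k [ee ev ue]]]] := fitting_idempotent u (aff_finite X_fin).
exists v; rewrite -(frac_of_toQh ub) mulrA.
suff -> : val v * val u = 1 by rewrite mul1r.
have [w bw] := to_loc_inv (S := hnzd_mulset X) hb.
have [z xz] := to_loc_inv (S := hnzd_mulset X) (hnzd_x0X X_fin d).
have e1 : (val u) ^+ k * (1 - val e) = 0.
  by have := congr1 val ue; rewrite rmorphM rmorphXn rmorphB rmorph1 rmorph0.
have uw : val u * (xi ^+ d * w) = 1.
  by rewrite mulrA (frac_of_toQh ub).
have := congr1 ( *%R ((xi ^+ d * w) ^+ k)) e1.
rewrite mulr0 mulrA -exprMn [_ * val u]mulrC uw expr1n mul1r => /eqP.
by rewrite subr_eq0 => /eqP ->; rewrite ev rmorphM mulrC.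
Qed.

Lemma Qh_deg0_aff q : Qh_deg 0 q -> exists s, val s = q.
Proof.
move=> [d [e [a [b [da eb hb /esym/eqP]]]]]; rewrite subr_eq0 => /eqP[de] qE; subst e.
have [v vb] := hnzd_inverse eb hb; have sa := dehomP X_fin da.
exists (dehom d a * v); rewrite rmorphM /=; apply: (toQh_x0X_cancel X_fin (k := d)).
have qb : q * toQh X b = toQh X a by apply/(loc_fracP (S := hnzd_mulset X)).
by rewrite mulrAC (frac_of_toQh sa) -qb -vb mulrA mulrAC.
Qed.

Lemma aff_Qh_deg0 s : Qh_deg 0 (val s).
Proof.
have [i [a sa]] := frac_of_exists s; exists i, i, a, (x0 X ^+ i); split.
- by case: sa.
- exact: coord_deg_x0X.
- exact: hnzd_x0X.
- by rewrite subrr.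
- apply/(loc_fracP (S := hnzd_mulset X)); first exact: hnzd_x0X.
  by apply: etrans (frac_of_toQh sa); rewrite -(rmorphXn (toQh X)).
Qed.

(** Elements of Q^h(R) are Laurent polynomials in x_0 over S; the factor x_0^k clears the negative
    exponents. *)
Lemma Qh_expansion q : exists k M (s : nat -> aff X),
  q * xi ^+ k = \sum_(i < M) val (s i) * xi ^+ i.
Proof.
have [[d db] hb] := denP (repr q); have qb : q * toQh X (den (repr q)) = toQh X (num (repr q)).
  exact: (fracpairK q).
have [v vb] := hnzd_inverse db (conj (ex_intro _ d db) hb).
have [l [c vc]] := frac_of_exists v.
set a := num (repr q) in qb; pose b := a * c.
exists (d + l)%N, (msize (repr b)), (fun i => dehom i (coord_comp i b)).
transitivity (toQh X b).
  rewrite exprD -vb /b rmorphM /= -qb -(frac_of_toQh vc) !mulrA; congr (_ * _).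
  by rewrite mulrAC.
rewrite {1}(coord_sum_comp (leqnn (msize (repr b)))) rmorph_sum.
by apply: eq_bigr => i _; rewrite (frac_of_toQh (dehomP X_fin (coord_comp_deg i b))).
Qed.

(** After multiplication by x_0^N with F_N = S, the equation holds in R, where the right-hand side
    has no component below degree k + N. *)
Lemma expansion_low M (s : nat -> aff X) e k (c : coord X) :
  \sum_(i < M) val (s i) * xi ^+ (i + e) = xi ^+ k * toQh X c ->
  forall i, (i < M)%N -> (i + e < k)%N -> s i = 0.
Proof.
have [N full] := filt_full X_fin => sc i iM iek.
have /choice[a aP] j : exists a, frac_of N a (s j).
  by have : filt N (s j) by rewrite full.
have aN j : coord_deg N (a j) by case: (aP j).
have ac : \sum_(j < M) a j * x0 X ^+ (j + e) = x0 X ^+ (k + N) * c.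
  apply: toQh_inj; rewrite rmorph_sum rmorphM (rmorphXn (toQh X)) exprD /= mulrAC -sc mulr_suml.
  apply: eq_bigr => j _; rewrite rmorphM (rmorphXn (toQh X)) /= -(frac_of_toQh (aP j)).
  by rewrite mulrAC.
have := congr1 (coord_comp (N + (i + e))) ac.
rewrite (coord_compM _ _ (coord_deg_x0X X (k + N))) leqNgt [(k + N)%N]addnC ltn_add2l iek /=.
have deg j : coord_deg (N + (j + e)) (a j * x0 X ^+ (j + e)).
  by apply: coord_degM => //; exact: coord_deg_x0X.
rewrite raddf_sum (bigD1 (Ordinal iM)) //= (coord_comp_id _ (deg i)) eqxx big1 ?addr0 => [|j ji].
  move=> ai0; apply: (frac_of_uniq X_fin (aP i)).
  suff -> : a i = 0 by exact: frac_of0.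
  by case: (hnzd_x0X X_fin (i + e)) => _; apply; rewrite mulrC.
rewrite (coord_comp_id _ (deg j)); case: eqP => // /addnI/addIn e'.
by case/eqP: ji; apply: val_inj.
Qed.

Lemma L0_x0X k : L0 (xi ^+ k).
Proof.
exists 0%N, (x0 X ^+ k); split; last first.
  apply/(loc_fracP (S := hnzd_mulset X)); first exact: hnzd1.
  by rewrite -(rmorphXn (toQh X)) [to_loc _ 1]rmorph1 mulr1.
exists ('X^k); rewrite size_polyXn big_ord_recr /= coefXn eqxx rmorph1 mul1r big1 ?add0r // => i _.
by rewrite coefXn ltn_eqF ?rmorph0 ?mul0r.
Qed.

Section Trace.
Variable sigma : Qh X -> Qh X.
Hypothesis sigma_trace : trace_map sigma.

Lemma trace_zmod_morphism : zmod_morphism sigma.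
Proof.
have [[_ sD _ _] _] := sigma_trace => a b.
by apply/eqP; rewrite eq_sym subr_eq -sD subrK.
Qed.

HB.instance Definition _ :=
  GRing.isZmodMorphism.Build (Qh X) (Qh X) sigma trace_zmod_morphism.

Lemma trace_x0X k q : sigma (xi ^+ k * q) = xi ^+ k * sigma q.
Proof. by have [[_ _ sL _] _] := sigma_trace; apply: sL; exact: L0_x0X. Qed.

(** By expansion, q -> sigma (s q) vanishes on all of Q^h(R). Both s and 0 then represent the zero
    homomorphism in the basis sigma. *)
Lemma trace_nondegenerate s : (forall t, sigma (val (s * t)) = 0) -> s = 0.
Proof.
move=> s0; have [_ nondeg] := sigma_trace.
have [|g [_ uniq]] := nondeg (fun=> 0).
  exists 0%N, (fun=> 0), (fun _ _ => 0); split=> [[]//|a].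
  by rewrite big_ord0.
apply: val_inj; rewrite rmorph0 -(uniq 0) => [|q]; last by rewrite mul0r raddf0.
apply: esym; apply: uniq => q; apply: esym.
have [k [M [t qE]]] := Qh_expansion q.
have : xi ^+ k * sigma (val s * q) = 0.
  rewrite -trace_x0X mulrCA [xi ^+ k * q]mulrC qE mulr_sumr raddf_sum big1 // => i _ /=.
  by rewrite mulrA mulrC trace_x0X -(rmorphM val) s0 mulr0.
by rewrite mulrC => e; apply: (toQh_x0X_cancel X_fin (k := k)); rewrite e mul0r.
Qed.

(* Elements of the complementary module have no component of degree < -r.     *)
Lemma dedekind_compl_low g k M (s : nat -> aff X) : dedekind_compl sigma g ->
  g * xi ^+ k = \sum_(i < M) val (s i) * xi ^+ i ->
  forall i, (i < M)%N -> (i + r < k)%N -> s i = 0.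
Proof.
move=> [phi [psi [[_ _ ext] psiE]]] gE i iM irk; apply: trace_nondegenerate => t.
(* As F_r = S, a = t x_0^r is in R, so sigma (g t x_0^r) = phi a lies in R. Its coefficients sigma
   (s_j t) in degrees j + r - k < 0 must vanish. *)
have [a ta] : filt r t by have /(filt_reg X_fin) -> := leqnn r.
have /choice[w wP] (j : nat) : exists w : aff X, val w = sigma (val (s j * t)).
  apply: Qh_deg0_aff; have [[_ _ _ sG] _] := sigma_trace.
  by rewrite -[0]addr0; apply: sG; exact: aff_Qh_deg0.
rewrite -wP (_ : w i = 0) ?rmorph0 //.
apply: (expansion_low (M := M) (e := r) (k := k) (c := phi a)) => //.
rewrite -ext psiE -trace_x0X mulrA [xi ^+ k * g]mulrC gE mulr_suml raddf_sum.
apply: eq_bigr => j _ /=; rewrite wP -(frac_of_toQh ta) mulrC -trace_x0X exprD rmorphM /=.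
by congr sigma; rewrite [RHS]mulrACA mulrC.
Qed.

Lemma ideal_in_different j t a : (j < r)%N -> (forall u, filt j (u * t)) ->
  frac_of (2 * r).-1 a t -> dedekind_different sigma (toQh X a).
Proof.
move=> jr jt ta g cg; have [k [M [s gE]]] := Qh_expansion g.
have low := dedekind_compl_low cg gE.
have /choice[c cP] i : exists c, (i < M)%N ->
    val (t * s i) * xi ^+ ((2 * r).-1 + i) = xi ^+ k * toQh X c.
  have [iM|_] := ltnP i M; last by exists 0.
  (* Components of g of degree i - k < -r vanish. Otherwise (2r - 1) + i - k >= r - 1 >= j, so s_i t
     lies in the filtration step of that degree. *)
  have [irk|kir] := ltnP (i + r) k.
    by exists 0 => _; rewrite low // mulr0 !rmorph0 mul0r mulr0.
  have [c tc] : filt ((2 * r).-1 + i - k) (t * s i).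
    by rewrite mulrC; apply: filtS (jt (s i)); lia.
  exists c => _; rewrite -(frac_of_toQh tc) mulrCA -exprD subnKC //; lia.
exists (\sum_(i < M) c i); apply: (toQh_x0X_cancel X_fin (k := k)).
rewrite -mulrA gE mulr_sumr [RHS]mulrC rmorph_sum mulr_sumr.
apply: eq_bigr => i _; rewrite -cP // -(frac_of_toQh ta) exprD rmorphM /=.
by rewrite mulrACA.
Qed.

(** The element t x_0^{2r-1} of the different has degree 2r - 1 < 2r, where r > j >= 0 makes the
    predecessor exact; minimality forces it to be 0. *)
Lemma minimal_no_ideal : minimal_dedekind_different sigma -> no_ideal_below X r.
Proof.
move=> min j t jr jt.
have [a ta] : filt (2 * r).-1 t.
  by rewrite -[t]mul1r; apply: filtS (jt 1); lia.
have := ideal_in_different jr jt ta; rewrite min => -[b /coord_geP bE /toQh_inj ba].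
apply: (frac_of_uniq X_fin ta); suff -> : a = 0 by exact: frac_of0.
have da : coord_deg (2 * r).-1 a by case: ta.
by have := coord_comp_id (2 * r).-1 da; rewrite eqxx => <-; rewrite -ba bE //; lia.
Qed.

End Trace.
End Different.

Theorem proposition5p5 (K : fieldType) (n : nat) (X : pscheme K n)
    (X_dim0 : zero_dimensional X) (X_gor : locally_gorenstein X)
    (X_off : off_hyperplane X)
    (sigma : Qh X -> Qh X) (sigma_trace : trace_map sigma) :
  minimal_dedekind_different sigma <->
  cayley_bacharach X /\
  toQh X @` conductor_sq X = dedekind_different sigma.
Proof.
have X_fin : affine_finite X by case: X_dim0.
split=> [min|[/(cayley_bacharach_filt X_fin) none sq]].
  have none := minimal_no_ideal X_fin sigma_trace min.
  by split; [apply/(cayley_bacharach_filt X_fin)|rewrite (conductor_sq_ge X_fin none)].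
by rewrite /minimal_dedekind_different -sq (conductor_sq_ge X_fin none).
Qed.
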